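(* For every $\varepsilon>0$ there are constants $\delta>0$ and $c>0$ depending only on $\varepsilon$ such that the following holds. Let $p$ be a prime, $k\ge1$ an integer, $G=SL_2(\mathbf{F}_{p^k})$, and let $S\subset G$ be a set which is not contained in any proper subgroup of $G$ and satisfies $|S|<|G|^{1-\varepsilon}$. Then $$|S.S.S|\ge c\,|S|^{1+\delta}.$$
   Context: $\mathbf{F}_{p^k}$ is the finite field with $p^k$ elements, and $S.S.S=\{s_1s_2s_3: s_1,s_2,s_3\in S\}$. *)

(* Defs.v *)
From HB Require Import structures.
From mathcomp Require Import all_boot all_order all_algebra all_fingroup.
From mathcomp Require Import reals exp.

Set Implicit Arguments.
Unset Strict Implicit.
Unset Printing Implicit Defensive.

Import Order.TTheory GRing.Theory Num.Theory.

Local Open Scope ring_scope.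

(* SL_n(K), n >= 1, realized as a subgroup of the library's {'GL_n[K]}, whose
   elements are matrices of size n.-1.+1. *)
Definition SL (n : nat) (K : finComUnitRingType) : {set {'GL_n[K]}} :=
  [set g : {'GL_n[K]} | \det (GLval g) == 1].

Lemma SL_group_set (n : nat) (K : finComUnitRingType) : group_set (SL n K).
Proof.
apply/group_setP; split; first by rewrite inE GL_1E det1.
by move=> x y; rewrite !inE GL_ME => /eqP dx /eqP dy; rewrite det_mulmx dx dy mulr1.
Qed.

Canonical SL_group (n : nat) (K : finComUnitRingType) : {group {'GL_n[K]}} :=
  Group (SL_group_set n K).

(* Main.v *)
(* Pivot argument, without sum-product estimates.  Put B = S u S^-1 u {1}; by
   Ruzsa's triangle inequality it suffices to bound the growth of a fixed
   power of B.  Call x in SL_2 regular if tr x ^ 2 <> 4, so that its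
   centralizer is a torus, diagonal in a suitable frame over the algebraic
   closure.
   - If D is the part of B^2 in a torus and all entries of g are nonzero in its
     frame, then (d, s, d') |-> d g s g^-1 d' has bounded fibres on nearly all
     of D x D x D; hence |D|^3 = O(|B^22|).
   - Counting conjugates of regular elements with distinct traces, this bounds
     the number of traces of B^7.
   - For suitable h1, h2 an element g is determined up to two choices by the
     traces of g, g h1 and g h2; so the trace classes of B^5 are small, and by
     orbit-stabilizer the torus of every regular x in B^3 meets B^2 in about
     |B|^(1/3) elements.
   - Therefore, unless B grows, tori meeting B^2 in a regular element are
     permuted by conjugation by B, hence by all of SL_2.  Distinct tori share
     only +-1, so counting over all conjugates of one torus gives
     |SL_2|^2 = O(|B|^2) up to powers of the tripling constant. *)

Require Import Defs.
From HB Require Import structures.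
From mathcomp Require Import all_boot all_order all_algebra all_fingroup.
From mathcomp Require Import closed_field.
From mathcomp Require Import reals exp.
From mathcomp Require Import ring zify.

Set Implicit Arguments.
Unset Strict Implicit.
Unset Printing Implicit Defensive.

Import Order.TTheory GRing.Theory Num.Theory.

Local Open Scope ring_scope.

(** * Counting through the fibres of a map *)

Lemma leq_card_fiber (aT rT : finType) (f : aT -> rT) (A : {set aT})
    (Y : {set rT}) m :
  {in A, forall x, f x \in Y} ->
  {in A, forall x, #|[set y in A | f y == f x]| <= m}%N ->
  (#|A| <= m * #|Y|)%N.
Proof.
move=> fY fm; rewrite -sum1_card (partition_big f (mem Y)) //= mulnC -sum_nat_const.
apply: leq_sum => z _; rewrite sum1_card.
case: (set_0Vmem [set y in A | f y == z]) => [E|[x]].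
  apply: leq_trans (_ : #|[set y in A | f y == z]| <= m)%N; last by rewrite E cards0.
  by apply/subset_leq_card/subsetP => y; rewrite !inE.
rewrite inE => /andP[xA /eqP <-]; apply: leq_trans (fm x xA).
by apply/subset_leq_card/subsetP=> y; rewrite !inE.
Qed.

(** Quadratic equations deliver their root count in this form: two solutions different from a given
    one must coincide. *)
Lemma card_le2P (T : finType) (A : {set T}) :
  {in A & &, forall x y z, x != y -> x != z -> y = z} -> (#|A| <= 2)%N.
Proof.
move=> A2; rewrite leqNgt; apply/negP => /card_gt2P[x [y [z [[xA yA zA]]]]].
case=> xy yz zx; move/eqP: yz; apply; apply: A2 xA yA zA xy _.
by rewrite eq_sym.
Qed.

Lemma leq_card_imset_inj (aT rT : finType) (f : aT -> rT) (A : {set aT})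
    (Y : {set rT}) :
  {in A, forall x, f x \in Y} -> {in A &, injective f} -> (#|A| <= #|Y|)%N.
Proof.
move=> fY fI; rewrite -(card_in_imset fI); apply: subset_leq_card.
by apply/subsetP => _ /imsetP[x xA ->]; apply: fY.
Qed.

Lemma leq_imset_disjoint (aT rT : finType) (f : aT -> rT) (A : {set aT})
    (Y : {set rT}) m :
  {in Y, forall y, m <= #|[set x in A | f x == y]|}%N -> (m * #|Y| <= #|A|)%N.
Proof.
move=> fm; apply: leq_trans (_ : #|[set x in A | f x \in Y]| <= _)%N; last first.
  by apply/subset_leq_card/subsetP => x; rewrite inE => /andP[].
rewrite -[X in (_ <= X)%N]sum1_card (partition_big f (mem Y)) /=; last first.
  by move=> x; rewrite inE => /andP[].
rewrite mulnC -sum_nat_const.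
apply: leq_sum => y yY; rewrite sum1_card; apply: leq_trans (fm y yY) _.
apply/subset_leq_card/subsetP => x; rewrite !inE => /andP[xA /eqP fx].
by rewrite unfold_in /= inE xA fx yY /= eqxx.
Qed.

(** * Ruzsa calculus in a finite group *)

Section Products.
Variable gT : finGroupType.
Implicit Types A B X Y Z : {set gT}.
Local Open Scope group_scope.

(* The map (x, v) |-> (y x^-1, x z^-1), for a chosen factorisation v = y z^-1,
   is injective: the product of the two components is v. *)
Lemma ruzsa X Y Z : (#|X| * #|(Y * Z^-1)%g| <= #|(Y * X^-1)%g| * #|(X * Z^-1)%g|)%N.
Proof.
have fact v : v \in Y * Z^-1 -> {p | [&& p.1 \in Y, p.2 \in Z & v == p.1 * p.2^-1]}.
  move=> vYZ; apply: sigW; case/mulsgP: vYZ => y z' yY; rewrite mem_invg => zZ ->.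
  by exists (y, z'^-1); rewrite /= yY zZ invgK eqxx.
pose g v := if insub v : {? v | v \in Y * Z^-1} is Some w
            then sval (fact _ (valP w)) else (1, 1).
have gP v : v \in Y * Z^-1 -> [/\ (g v).1 \in Y, (g v).2 \in Z & v = (g v).1 * (g v).2^-1].
  move=> vYZ; rewrite /g insubT; case: (fact _ _) => p /= /and3P[-> ->] /eqP e.
  by split.
rewrite -!cardsX.
apply: (leq_card_imset_inj (f := fun xv => ((g xv.2).1 * xv.1^-1, xv.1 * (g xv.2).2^-1))).
  move=> [x v] /setXP[/= xX /gP[gY gZ _]].
  by apply/setXP; rewrite /= !mem_mulg ?mem_invg ?invgK.
move=> [x v] [x' v'] /setXP[/= xX /gP[_ _ vE]] /setXP[/= xX' /gP[_ _ vE']] [e1 e2].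
have ev : v = v'.
  have := congr2 (fun a b => a * b) e1 e2.
  by rewrite /= !mulgA !mulgKV -vE -vE'.
by move: e2; rewrite ev => /mulIg ->.
Qed.

Lemma ruzsa_mul X Y Z : (#|X| * #|(Y * Z)%g| <= #|(Y * X^-1)%g| * #|(X * Z)%g|)%N.
Proof. by have := ruzsa X Y Z^-1; rewrite invgK. Qed.

Lemma leq_card_mulr X Y : Y != set0 -> (#|X| <= #|(X * Y)%g|)%N.
Proof.
case/set0Pn => y yY; rewrite -(card_rcoset X y); apply: subset_leq_card.
by rewrite mulgS // sub1set.
Qed.

Section Tripling.
Variable A : {set gT}.
Hypothesis A0 : A != set0.
Let n := #|A|.
Let m := #|A * A * A|.

Let Ai0 : A^-1 != set0.
Proof. by rewrite -card_gt0 card_invg card_gt0. Qed.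

Let AA : (#|(A * A)%g| <= m)%N.
Proof. exact: leq_card_mulr. Qed.

Let AiAi : (#|(A^-1 * A^-1)%g| <= m)%N.
Proof. by rewrite -invMg card_invg. Qed.

Let AAAi : (n * #|(A * A * A^-1)%g| <= m * m)%N.
Proof.
rewrite -[n](card_invg A); apply: leq_trans (ruzsa_mul _ _ _) _.
by rewrite invgK leq_mul.
Qed.

Let AiAA : (n * #|(A^-1 * A * A)%g| <= m * m)%N.
Proof.
rewrite -mulgA; apply: leq_trans (ruzsa_mul _ _ _) _.
by rewrite mulgA leq_mul.
Qed.

Let AAiAi : (n * #|(A * A^-1 * A^-1)%g| <= m * m)%N.
Proof. by rewrite -[(_ * _)%g]invgK card_invg !invMg !invgK mulgA. Qed.

Let AiAiA : (n * #|(A^-1 * A^-1 * A)%g| <= m * m)%N.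
Proof. by rewrite -[(_ * _ * _)%g]invgK card_invg !invMg !invgK mulgA. Qed.

Let AAiA : (n ^ 2 * #|(A * A^-1 * A)%g| <= m ^ 3)%N.
Proof.
have := ruzsa_mul A^-1 A (A^-1 * A); rewrite card_invg invgK !mulgA -/n => h.
have := leq_mul (leqnn n) h; rewrite mulnA => /leq_trans; apply.
by rewrite mulnCA expnS leq_mul.
Qed.

Let AiAAi : (n ^ 2 * #|(A^-1 * A * A^-1)%g| <= m ^ 3)%N.
Proof. by rewrite -[(_ * _ * _)%g]invgK card_invg !invMg !invgK mulgA. Qed.

(** [k] counts the words in [A], [A^-1], [1] that cover [X]; each word costs at most m^3 / n^2. The
    worst words, A A^-1 A and its inverse, need the triangle inequality twice, hence the n^2. *)
Let bnd k X := (n ^ 2 * #|X| <= k * m ^ 3)%N.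

Let bndU k l X Y : bnd k X -> bnd l Y -> bnd (k + l) (X :|: Y).
Proof.
move=> hX hY; rewrite /bnd mulnDl; apply: leq_trans (leq_add hX hY).
by rewrite -mulnDr leq_mul // cardsU leq_subr.
Qed.

Let bndW X Y : (#|X| <= #|Y|)%N -> bnd 1 Y -> bnd 1 X.
Proof. by move=> XY; apply: leq_trans; rewrite leq_mul. Qed.

Let nm : (n <= m)%N.
Proof. by apply: leq_trans AA; apply: leq_card_mulr. Qed.

Let bnd2 X : (n * #|X| <= m * m)%N -> bnd 1 X.
Proof.
move=> h; rewrite /bnd mul1n -mulnA; apply: leq_trans (_ : n * (m * m) <= _)%N.
  by rewrite leq_mul.
by rewrite (expnS m 2) leq_mul.
Qed.

Let signed X := [|| X == A, X == A^-1 | X == 1].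

Let bnd_prod X Y Z : signed X -> signed Y -> signed Z -> bnd 1 (X * Y * Z).
Proof.
have signed3 U V W : (U == A) || (U == A^-1) -> (V == A) || (V == A^-1) ->
    (W == A) || (W == A^-1) -> bnd 1 (U * V * W).
  case/orP=> /eqP->; case/orP=> /eqP->; case/orP=> /eqP->;
    try by apply: bnd2.
  - by apply: bnd2; rewrite leq_mul // ?nm.
  - by rewrite /bnd mul1n.
  - by rewrite /bnd mul1n.
  apply: bnd2; rewrite leq_mul //.
  by rewrite -[(_ * _ * _)%g]invgK card_invg !invMg !invgK mulgA.
have signed2 U V : (U == A) || (U == A^-1) -> (V == A) || (V == A^-1) ->
    bnd 1 (U * V).
  move=> hU hV; apply: bndW (signed3 U V A hU hV _); rewrite ?eqxx //.
  exact: leq_card_mulr.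
have signed1 U : (U == A) || (U == A^-1) -> bnd 1 U.
  move=> hU; apply: bndW (signed2 U A hU _); rewrite ?eqxx //.
  exact: leq_card_mulr.
have signed0 : bnd 1 1.
  by apply: bndW (signed1 A _); rewrite ?eqxx // cards1 card_gt0.
rewrite /signed !orbA.
case/orP=> hX; case/orP=> hY; case/orP=> hZ; try exact: signed3;
  do ?[move/eqP: hX => ->]; do ?[move/eqP: hY => ->]; do ?[move/eqP: hZ => ->];
  rewrite ?mul1g ?mulg1; by [apply: signed2 | apply: signed1 | apply: signed0].
Qed.

(** Expanding the cube of the three-term union gives 27 words of length three, each controlled by
    [bnd_prod]. *)
Lemma card_symmetric_cube (B := A :|: A^-1 :|: 1) :
  (#|A| ^ 2 * #|B ^+ 3| <= 27 * #|(A * A * A)%g| ^ 3)%N.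
Proof.
have EB : B = A :|: A^-1 :|: 1 by [].
move: (B) EB => {}B EB.
have sA : signed A by rewrite /signed eqxx.
have sAi : signed A^-1 by rewrite /signed eqxx orbT.
have s1 : signed 1 by rewrite /signed eqxx !orbT.
rewrite !expgS expg0 mulg1 !mulgA -/(bnd 27 _).
have b3 X Y : signed X -> signed Y -> bnd 3 (X * Y * B).
  by move=> sX sY; rewrite {1}EB !mulgU; apply: (@bndU 2 1 _ _ (@bndU 1 1 _ _ _ _)); apply: bnd_prod.
have b9 X : signed X -> bnd 9 (X * B * B).
  move=> sX; rewrite {1}EB !mulgU !mulUg.
  by apply: (@bndU 6 3 _ _ (@bndU 3 3 _ _ _ _)); apply: b3.
rewrite {1}EB !mulUg.
by apply: (@bndU 18 9 _ _ (@bndU 9 9 _ _ _ _)); apply: b9.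
Qed.

End Tripling.

Section Powers.
Variable B : {set gT}.
Hypothesis B1 : 1 \in B.
Hypothesis BV : B^-1 = B.

Lemma expgV_set k : (B ^+ k)^-1 = B ^+ k.
Proof.
by elim: k => [|k IH]; rewrite ?invg1 ?expg0 ?invg1 // {1}expgSr invMg IH BV -expgS.
Qed.

Lemma mem_expg_set k : 1 \in B ^+ k.
Proof.
elim: k => [|k IH]; first by rewrite expg0 set11.
by rewrite expgS -[1]mulg1 mem_mulg.
Qed.

Lemma expg_set_sub j k : (j <= k)%N -> B ^+ j \subset B ^+ k.
Proof.
move/subnKC => <-; elim: (k - j)%N => [|l IH]; first by rewrite addn0.
apply: subset_trans IH _; rewrite addnS expgSr; apply/subsetP => x xB.
by rewrite -[x]mulg1 mem_mulg.
Qed.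

Lemma mem_expgM j k x y : x \in B ^+ j -> y \in B ^+ k -> x * y \in B ^+ (j + k).
Proof. by move=> xB yB; rewrite expgnDr mem_mulg. Qed.

Lemma mem_expgV k x : x \in B ^+ k -> x^-1 \in B ^+ k.
Proof. by rewrite -{2}expgV_set mem_invg invgK. Qed.

(** Each further factor costs |B^3| / |B|: split B^(k+2) as B^k B^2 and insert B = B^-1 in the
    triangle inequality. *)
Lemma leq_card_expg k : (#|B ^+ k.+1| * #|B| ^ k <= #|B ^+ 3| ^ k * #|B|)%N.
Proof.
elim: k => [|k IH]; first by rewrite expg1 !expn0 muln1 mul1n.
have h : (#|B| * #|B ^+ k.+2| <= #|B ^+ k.+1| * #|B ^+ 3|)%N.
  have := ruzsa_mul B (B ^+ k) (B ^+ 2).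
  by rewrite BV -expgSr -[B * B ^+ 2]expgS -expgnDr addn2.
rewrite !expnS mulnA [(#|_| * #|B|)%N]mulnC; apply: leq_trans (leq_mul h (leqnn _)) _.
by rewrite mulnAC [X in (X <= _)%N]mulnC -mulnA leq_mul.
Qed.

End Powers.
End Products.

(** * Entries of 2 by 2 matrices *)

Section Matrix2.
Variable R : comNzRingType.
Implicit Types A B C : 'M[R]_2.

Lemma mulmx2E A B i j : (A *m B) i j = A i 0 * B 0 j + A i 1 * B 1 j.
Proof.
rewrite mxE !big_ord_recl big_ord0 addr0.
by rewrite (_ : lift ord0 ord0 = 1 :> 'I_2) //; apply: val_inj.
Qed.

Lemma submx2E A B i j : (A - B) i j = A i j - B i j.
Proof. by rewrite !mxE. Qed.

Lemma mxtrace2 A : \tr A = A 0 0 + A 1 1.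
Proof.
rewrite /mxtrace !big_ord_recl big_ord0 addr0.
by rewrite (_ : lift ord0 ord0 = 1 :> 'I_2) //; apply: val_inj.
Qed.

Lemma det2 A : \det A = A 0 0 * A 1 1 - A 0 1 * A 1 0.
Proof.
rewrite (expand_det_row _ 0) !big_ord_recl big_ord0 addr0.
rewrite /cofactor !det_mx11 !mxE /= expr0 expr1 mul1r mulN1r mulrN.
by congr (A _ _ * A _ _ - A _ _ * A _ _); apply: val_inj.
Qed.

Lemma ord2P (P : 'I_2 -> Prop) : P 0 -> P 1 -> forall i, P i.
Proof.
move=> P0 P1 [[|[|//]] lti].
  by rewrite (_ : Ordinal lti = 0) //; apply: val_inj.
by rewrite (_ : Ordinal lti = 1) //; apply: val_inj.
Qed.

Lemma matrix2P A B : A 0 0 = B 0 0 -> A 0 1 = B 0 1 -> A 1 0 = B 1 0 ->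
  A 1 1 = B 1 1 -> A = B.
Proof. by move=> *; apply/matrixP; do 2!elim/ord2P. Qed.

Definition mx2 (a b c d : R) : 'M[R]_2 :=
  \matrix_(i, j) if i == 0 then if j == 0 then a else b
                 else if j == 0 then c else d.

Lemma mx2E a b c d : (mx2 a b c d 0 0 = a) * (mx2 a b c d 0 1 = b) *
  (mx2 a b c d 1 0 = c) * (mx2 a b c d 1 1 = d).
Proof. by rewrite !mxE. Qed.

Lemma mx2_1 : 1%:M = mx2 1 0 0 1.
Proof. by apply: matrix2P; rewrite !mx2E !mxE. Qed.

End Matrix2.

(** * Recovering a matrix of determinant 1 from three traces *)

Section Commutator.
Variable F : fieldType.
Implicit Types A B C : 'M[F]_2.

Definition comm_det A B := \det (A *m B - B *m A).

(* A matrix whose pairings with 1, A, B all vanish is a multiple of the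
   commutator [A, B]; hence det is a genuine quadratic on the line of
   matrices having three prescribed traces. *)
Lemma trace_coordinates A B X Y Z : comm_det A B != 0 ->
  \det X = 1 -> \det Y = 1 -> \det Z = 1 ->
  \tr X = \tr Y -> \tr (X *m A) = \tr (Y *m A) -> \tr (X *m B) = \tr (Y *m B) ->
  \tr X = \tr Z -> \tr (X *m A) = \tr (Z *m A) -> \tr (X *m B) = \tr (Z *m B) ->
  X != Y -> X != Z -> Y = Z.
Proof.
rewrite /comm_det !det2 !mxtrace2 !submx2E !mulmx2E.
move: (A 0 0) (A 0 1) (A 1 0) (A 1 1) => a b c d.
move: (B 0 0) (B 0 1) (B 1 0) (B 1 1) => a' b' c' d'.
(* Here y is orthogonal to two vectors of F^3 and v is, up to sign, their cross product. The last
   condition makes v0 or v1 nonzero, so y can be divided by v. *)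
have line y0 y1 y2 : y0 * (a - d) + y1 * c + y2 * b = 0 ->
    y0 * (a' - d') + y1 * c' + y2 * b' = 0 ->
    let v0 := b * c' - b' * c in let v1 := b' * (a - d) - b * (a' - d') in
    let v2 := c * (a' - d') - c' * (a - d) in
    v0 ^+ 2 + v1 * v2 != 0 ->
    exists s, [/\ y0 = s * v0, y1 = s * v1 & y2 = s * v2].
  move=> h h' v0 v1 v2 nz.
  have e01 : y0 * v1 = y1 * v0.
    apply/eqP; rewrite -subr_eq0.
    rewrite (_ : _ - _ = b' * (y0 * (a - d) + y1 * c + y2 * b) -
       b * (y0 * (a' - d') + y1 * c' + y2 * b')); last by rewrite /v0 /v1; ring.
    by rewrite h h' !mulr0 subrr.
  have e02 : y0 * v2 = y2 * v0.
    apply/eqP; rewrite -subr_eq0.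
    rewrite (_ : _ - _ = c * (y0 * (a' - d') + y1 * c' + y2 * b') -
       c' * (y0 * (a - d) + y1 * c + y2 * b)); last by rewrite /v0 /v2; ring.
    by rewrite h h' !mulr0 subrr.
  have e12 : y1 * v2 = y2 * v1.
    apply/eqP; rewrite -subr_eq0.
    rewrite (_ : _ - _ = (a' - d') * (y0 * (a - d) + y1 * c + y2 * b) -
       (a - d) * (y0 * (a' - d') + y1 * c' + y2 * b')); last by rewrite /v1 /v2; ring.
    by rewrite h h' !mulr0 subrr.
  have [v00|v0N0] := eqVneq v0 0.
    have v1N0 : v1 != 0 by move: nz; rewrite v00 expr0n add0r mulf_eq0; case/norP.
    exists (y1 / v1); split; apply: (mulIf v1N0).
    - by rewrite e01 v00 !mulr0 mul0r.
    - by rewrite divfK.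
    by rewrite mulrAC divfK.
  exists (y0 / v0); split; apply: (mulIf v0N0).
  - by rewrite divfK.
  - by rewrite mulrAC divfK.
  by rewrite mulrAC divfK.
move=> nz dX dY dZ t1 t2 t3 t4 t5 t6.
have {}nz : (b * c' - b' * c) ^+ 2 +
    (b' * (a - d) - b * (a' - d')) * (c * (a' - d') - c' * (a - d)) != 0.
  by move: nz; rewrite -oppr_eq0; congr (~~ (_ == 0)); ring.
have diff (U : 'M[F]_2) : X 0 0 + X 1 1 = U 0 0 + U 1 1 ->
    X 0 0 * a + X 0 1 * c + (X 1 0 * b + X 1 1 * d) =
    U 0 0 * a + U 0 1 * c + (U 1 0 * b + U 1 1 * d) ->
    X 0 0 * a' + X 0 1 * c' + (X 1 0 * b' + X 1 1 * d') =
    U 0 0 * a' + U 0 1 * c' + (U 1 0 * b' + U 1 1 * d') ->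
    exists s, [/\ U 0 0 = X 0 0 + s * (b * c' - b' * c),
      U 0 1 = X 0 1 + s * (b' * (a - d) - b * (a' - d')),
      U 1 0 = X 1 0 + s * (c * (a' - d') - c' * (a - d)) &
      U 1 1 = X 1 1 - s * (b * c' - b' * c)].
  move=> h1 h2 h3.
  have u3 : U 1 1 = X 1 1 - (U 0 0 - X 0 0).
    by rewrite opprB addrA [X 1 1 + _]addrC h1 addrAC subrr add0r.
  have [s [s0 s1 s2]] : exists s, [/\ U 0 0 - X 0 0 = s * (b * c' - b' * c),
      U 0 1 - X 0 1 = s * (b' * (a - d) - b * (a' - d')) &
      U 1 0 - X 1 0 = s * (c * (a' - d') - c' * (a - d))].
    apply: line nz.
      by move/eqP: h2; rewrite eq_sym -subr_eq0 u3 => /eqP <-; ring.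
    by move/eqP: h3; rewrite eq_sym -subr_eq0 u3 => /eqP <-; ring.
  exists s; split; last by rewrite -s0.
  - by rewrite -s0 addrC subrK.
  - by rewrite -s1 addrC subrK.
  by rewrite -s2 addrC subrK.
have [s [s0 s1 s2 s3]] := diff Y t1 t2 t3.
have [t [r0 r1 r2 r3]] := diff Z t4 t5 t6.
move=> XY XZ.
have sN0 : s != 0.
  apply: contraNneq XY => s_0; apply/eqP/matrix2P.
  - by rewrite s0 s_0 mul0r addr0.
  - by rewrite s1 s_0 mul0r addr0.
  - by rewrite s2 s_0 mul0r addr0.
  by rewrite s3 s_0 mul0r subr0.
have tN0 : t != 0.
  apply: contraNneq XZ => s_0; apply/eqP/matrix2P.
  - by rewrite r0 s_0 mul0r addr0.
  - by rewrite r1 s_0 mul0r addr0.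
  - by rewrite r2 s_0 mul0r addr0.
  by rewrite r3 s_0 mul0r subr0.
move: nz s0 s1 s2 s3 r0 r1 r2 r3.
set v0 := b * c' - _; set v1 := b' * _ - _; set v2 := c * _ - _ => nz s0 s1 s2 s3 r0 r1 r2 r3.
pose L := (X 1 1 - X 0 0) * v0 - X 0 1 * v2 - X 1 0 * v1.
(* Along X + w V the determinant is 1 + w L - w^2 (v0^2 + v1 v2). Once the root w = 0 is divided
   out, a linear equation remains, which has one solution. *)
have root_eq (U : 'M[F]_2) w : w != 0 ->
    U 0 0 * U 1 1 - U 0 1 * U 1 0 = 1 -> U 0 0 = X 0 0 + w * v0 ->
    U 0 1 = X 0 1 + w * v1 -> U 1 0 = X 1 0 + w * v2 -> U 1 1 = X 1 1 - w * v0 ->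
    w * (v0 ^+ 2 + v1 * v2) = L.
  move=> wN0 dU u0 u1 u2 u3; apply: (mulfI wN0).
  apply/eqP; rewrite eq_sym -subr_eq0.
  rewrite (_ : _ - _ = (U 0 0 * U 1 1 - U 0 1 * U 1 0) -
      (X 0 0 * X 1 1 - X 0 1 * X 1 0)); first by rewrite dU dX subrr.
  by rewrite u0 u1 u2 u3 /L; ring.
have st : s = t.
  by apply: (mulIf nz); rewrite (root_eq Y s) // (root_eq Z t).
by apply: matrix2P; rewrite ?s0 ?r0 ?s1 ?r1 ?s2 ?r2 ?s3 ?r3 st.
Qed.

End Commutator.

(** * Eigenframes over an algebraically closed field *)

Definition gmx (F : finFieldType) (g : {'GL_2[F]}) : 'M[F]_2 := GLval g.

(* The matrix of g in the basis of K^2 formed by the rows of P, for row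
   vectors. *)
HB.lock Definition frame_mx (F : finFieldType) (K : closedFieldType)
    (phi : {rmorphism F -> K}) (P : 'M[K]_2) (g : {'GL_2[F]}) : 'M[K]_2 :=
  P *m map_mx phi (gmx g) *m invmx P.

Section Frames.
Variables (F : finFieldType) (K : closedFieldType) (phi : {rmorphism F -> K}).
Implicit Types (g h x : {'GL_2[F]}) (P Q : 'M[K]_2).

Local Notation frame := (@frame_mx F K phi).

Lemma gmxM g h : gmx (g * h)%g = gmx g *m gmx h.
Proof. by rewrite /gmx GL_MxE. Qed.

Lemma gmx1 : gmx (1%g : {'GL_2[F]}) = 1%:M.
Proof. by rewrite /gmx GL_1E. Qed.

Lemma gmx_inj : injective (@gmx F).
Proof. exact: val_inj. Qed.

Lemma SL_det g : g \in SL 2 F -> \det (gmx g) = 1.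
Proof. by rewrite inE => /eqP. Qed.

Lemma frameM P g h : P \in unitmx ->
  frame P (g * h)%g = frame P g *m frame P h.
Proof.
by move=> uP; rewrite !frame_mx.unlock gmxM map_mxM !mulmxA mulmxKV // !mulmxA.
Qed.

Lemma frame1 P : P \in unitmx -> frame P 1%g = 1%:M.
Proof. by move=> uP; rewrite !frame_mx.unlock gmx1 map_mx1 mulmx1 mulmxV. Qed.

Lemma det_frame P g : P \in unitmx -> \det (frame P g) = phi (\det (gmx g)).
Proof.
move=> uP; rewrite frame_mx.unlock !det_mulmx det_inv mulrAC mulfV ?mul1r ?det_map_mx //.
by rewrite -unitfE -unitmxE.
Qed.

Lemma tr_frame P g : P \in unitmx -> \tr (frame P g) = phi (\tr (gmx g)).
Proof. by move=> uP; rewrite frame_mx.unlock mxtrace_mulC mulmxA mulVmx // mul1mx trace_map_mx. Qed.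

Lemma frame_inj P : P \in unitmx -> injective (frame P).
Proof.
move=> uP g h /(congr1 (fun M => invmx P *m M *m P)).
rewrite !frame_mx.unlock !mulmxA !mulVmx // !mul1mx !mulmxKV // => /map_mx_inj.
exact: gmx_inj.
Qed.

Lemma frame_det1 P g : P \in unitmx -> g \in SL 2 F ->
  frame P g 0 0 * frame P g 1 1 - frame P g 0 1 * frame P g 1 0 = 1.
Proof. by move=> uP gSL; rewrite -det2 det_frame // SL_det // rmorph1. Qed.

Lemma frameV P g : P \in unitmx -> g \in SL 2 F ->
  frame P g^-1%g = mx2 (frame P g 1 1) (- frame P g 0 1)
                       (- frame P g 1 0) (frame P g 0 0).
Proof.
move=> uP gSL; set A := mx2 _ _ _ _.
have Ag : A *m frame P g = 1%:M.
  have := frame_det1 uP gSL.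
  by move=> e; rewrite mx2_1 /A; apply: matrix2P; rewrite !mulmx2E !mx2E -?e; ring.
have gg : frame P g *m frame P g^-1%g = 1%:M by rewrite -frameM // mulgV frame1.
by rewrite -[LHS]mul1mx -Ag -mulmxA gg mulmx1.
Qed.

Lemma frame_conj P g (M : 'M[K]_2) : P \in unitmx ->
  P *m map_mx phi (gmx g) = M *m P -> frame P g = M.
Proof. by move=> uP e; rewrite !frame_mx.unlock e mulmxK. Qed.

(** tr^2 - 4 is the discriminant of the characteristic polynomial of a determinant 1 matrix, so this
    says that the eigenvalues are distinct, in characteristic 2 as well. *)
Definition regular g := \tr (gmx g) ^+ 2 != 4%:R.

Lemma closed_quadratic (t : K) : exists a, a ^+ 2 - t * a + 1 = 0.
Proof.
have [a ea] := solve_monicpoly (fun i => if i == 0%N then -1 else t) (isT : (0 < 2)%N).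
exists a; rewrite ea !big_ord_recl big_ord0 /= expr0 mulr1 addr0 expr1; ring.
Qed.

Lemma regular_frame g : g \in SL 2 F -> regular g ->
  exists2 P, P \in unitmx & frame P g 0 1 = 0 /\ frame P g 1 0 = 0.
Proof.
move=> gSL; rewrite /regular => reg.
set X := map_mx phi (gmx g).
have dX : X 0 0 * X 1 1 - X 0 1 * X 1 0 = 1.
  by rewrite -det2 det_map_mx SL_det // rmorph1.
have tX : (X 0 0 + X 1 1) ^+ 2 != 4%:R.
  by rewrite -mxtrace2 trace_map_mx -rmorphXn -[4%:R](rmorph_nat phi) fmorph_eq.
have [a ea] := closed_quadratic (X 0 0 + X 1 1).
pose d := X 0 0 + X 1 1 - a.
have ead : a * d = 1 by rewrite -[RHS]subr0 -ea /d; ring.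
have aNd : d - a != 0.
  apply: contraNneq tX => e; rewrite -subr_eq0.
  have : (d - a) ^+ 2 = (X 0 0 + X 1 1) ^+ 2 - 4%:R * (a * d) by rewrite /d; ring.
  by rewrite e ead mulr1 expr0n => <-.
have key : (a - X 0 0) * (a - X 1 1) = X 0 1 * X 1 0.
  apply/eqP; rewrite -subr_eq0; apply/eqP; rewrite -[RHS]ea -dX; ring.
have finish P : \det P != 0 -> P *m X = mx2 a 0 0 d *m P ->
    exists2 P, P \in unitmx & frame P g 0 1 = 0 /\ frame P g 1 0 = 0.
  move=> uP e; exists P; first by rewrite unitmxE unitfE.
  by rewrite (frame_conj _ e) ?mx2E // unitmxE unitfE.
have kd : (d - X 0 0) * (d - X 1 1) = X 0 1 * X 1 0 by rewrite -key /d; ring.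
(* The rows of P are left eigenvectors for a and d, written by means of whichever off-diagonal entry
   is nonzero; if both vanish, X is already diagonal. *)
have [x10|x10] := eqVneq (X 1 0) 0; last first.
  apply: (finish (mx2 (X 1 0) (a - X 0 0) (X 1 0) (d - X 0 0))).
    by rewrite det2 !mx2E (_ : _ - _ = X 1 0 * (d - a)) ?mulf_neq0 //; ring.
  apply: matrix2P; rewrite !mulmx2E !mx2E; try ring.
    by rewrite mulrC -key; ring.
  by rewrite mulrC -kd; ring.
have [x01|x01] := eqVneq (X 0 1) 0; last first.
  apply: (finish (mx2 (a - X 1 1) (X 0 1) (d - X 1 1) (X 0 1))).
    rewrite det2 !mx2E (_ : _ - _ = - (X 0 1 * (d - a))); last by ring.
    by rewrite oppr_eq0 mulf_neq0.
  apply: matrix2P; rewrite !mulmx2E !mx2E; try ring.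
    by rewrite -key; ring.
  by rewrite -kd; ring.
exists 1%:M; first exact: unitmx1.
by rewrite !frame_mx.unlock mul1mx invmx1 mulmx1 -/X.
Qed.

(** A non-scalar matrix with a double eigenvalue is conjugate to a Jordan block. *)
Lemma nonregular_frame g : g \in SL 2 F -> ~~ regular g -> ~~ is_scalar_mx (gmx g) ->
  exists2 P, P \in unitmx &
    [/\ frame P g 0 0 = frame P g 1 1, frame P g 0 1 != 0 & frame P g 1 0 = 0].
Proof.
move=> gSL; rewrite /regular negbK => /eqP nreg nscal.
set X := map_mx phi (gmx g).
have dX : X 0 0 * X 1 1 - X 0 1 * X 1 0 = 1.
  by rewrite -det2 det_map_mx SL_det // rmorph1.
have tX : (X 0 0 + X 1 1) ^+ 2 = 4%:R.
  by rewrite -mxtrace2 trace_map_mx -rmorphXn nreg rmorph_nat.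
have [a ea] := closed_quadratic (X 0 0 + X 1 1).
(* Showing that the square of tr X - 2a vanishes avoids dividing by 2, so characteristic 2 is
   included. *)
have ea2 : X 0 0 + X 1 1 = a + a.
  apply/eqP; rewrite eq_sym -subr_eq0 -sqrf_eq0.
  rewrite (_ : _ ^+ 2 = 4%:R * (a ^+ 2 - (X 0 0 + X 1 1) * a + 1) +
     ((X 0 0 + X 1 1) ^+ 2 - 4%:R)); last by ring.
  by rewrite ea tX mulr0 subrr addr0.
have key : (a - X 0 0) * (a - X 1 1) = X 0 1 * X 1 0.
  apply/eqP; rewrite -subr_eq0; apply/eqP; rewrite -[RHS]ea -dX; ring.
have x11 : X 1 1 = a + a - X 0 0 by rewrite -ea2 addrC addKr.
have [x10|x10] := eqVneq (X 1 0) 0; last first.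
  have uP : mx2 0 1 (X 1 0) (a - X 0 0) \in unitmx.
    by rewrite unitmxE unitfE det2 !mx2E mul0r mul1r sub0r oppr_eq0.
  exists (mx2 0 1 (X 1 0) (a - X 0 0)) => //.
  rewrite (@frame_conj _ _ (mx2 a 1 0 a)) // ?mx2E ?oner_eq0 //.
  apply: matrix2P; rewrite !mulmx2E !mx2E ?x11; try ring.
  by rewrite mulrC -key x11; ring.
exists 1%:M; first exact: unitmx1.
rewrite !frame_mx.unlock mul1mx invmx1 mulmx1 -/X x10.
have x00 : X 0 0 = a.
  have : (a - X 0 0) ^+ 2 = 0.
    by move/eqP: key; rewrite x10 mulr0 x11 -oppr_eq0 => /eqP <-; ring.
  by move/eqP; rewrite sqrf_eq0 subr_eq0 => /eqP.
have e01 : X 0 0 = X 1 1 by rewrite x11 x00 addrK.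
split=> //; apply: contraNneq nscal => x01; apply/is_scalar_mxP.
exists (gmx g 0 0); apply: (map_mx_inj (f := phi)); rewrite -/X map_scalar_mx.
have xE i j : phi (gmx g i j) = X i j by rewrite mxE.
apply: matrix2P; rewrite !mxE ?mulr1n ?mulr0n //.
- by move: x01; rewrite mxE.
- by move: x10; rewrite mxE.
by rewrite !xE.
Qed.

End Frames.

(** * Escape of a generating set from special positions *)

Section Escape.
Variables (F : finFieldType) (K : closedFieldType) (phi : {rmorphism F -> K}).
Implicit Types (g h x : {'GL_2[F]}) (P Q : 'M[K]_2).

Local Notation frame := (@frame_mx F K phi).

Lemma SL_mx2 (a b c d : F) : a * d - b * c = 1 ->
  exists2 g, g \in SL 2 F & gmx g = mx2 a b c d.
Proof.
move=> e; have u : mx2 a b c d \in unitmx by rewrite unitmxE det2 !mx2E e unitr1.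
exists (FinRing.unit _ u) => //.
rewrite inE; apply/eqP; transitivity (\det (mx2 a b c d)) => //.
by rewrite det2 !mx2E.
Qed.

Lemma mulmx2N (A M : 'M[K]_2) i j k l : i != j ->
  (A *m M) k l = A k i * M i l + A k j * M j l.
Proof.
rewrite mulmx2E.
by elim/ord2P: i; elim/ord2P: j => //= _; rewrite addrC.
Qed.

Lemma frame_mulP P g : P \in unitmx ->
  frame P g *m P = P *m map_mx phi (gmx g).
Proof. by move=> uP; rewrite frame_mx.unlock mulmxKV. Qed.

Lemma unitmx2_row P i : P \in unitmx -> (P i 0 != 0) || (P i 1 != 0).
Proof.
move=> uP; rewrite -negb_and; apply: contraTN uP => /andP[/eqP p0 /eqP p1].
rewrite unitmxE unitfE negbK det2.
by elim/ord2P: i p0 p1 => -> ->; rewrite ?(mul0r, mulr0) subrr.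
Qed.

Lemma unitmx2_col P j : P \in unitmx -> (P 0 j != 0) || (P 1 j != 0).
Proof.
by move=> uP; have := @unitmx2_row P^T j; rewrite unitmx_tr !mxE; apply.
Qed.

Variable B : {set {'GL_2[F]}}.
Hypothesis BSL : B \subset SL 2 F.
Hypothesis Bgen : forall H : {group {'GL_2[F]}}, H \proper SL 2 F -> ~~ (B \subset H).

(** In a finite group, a subset containing 1 and closed under products is a subgroup; a proper one
    cannot contain the generating set. *)
Lemma generating_escape (P : pred {'GL_2[F]}) :
  P 1%g -> {in SL 2 F &, forall g h, P g -> P h -> P (g * h)%g} ->
  (exists2 g, g \in SL 2 F & ~~ P g) -> exists2 b, b \in B & ~~ P b.
Proof.
move=> P1 PM [g gSL nPg].
have gH : group_set [set g in SL 2 F | P g].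
  apply/group_setP; split; first by rewrite inE group1.
  move=> x y; rewrite inE => /andP[xS Px]; rewrite inE => /andP[yS Py].
  by rewrite inE groupM // PM.
have pH : Group gH \proper SL 2 F.
  rewrite properE; apply/andP; split; first by apply/subsetP => x; rewrite inE => /andP[].
  by apply/negP => /subsetP/(_ g gSL); rewrite inE gSL (negbTE nPg).
have /subsetPn[b bB] := Bgen pH; rewrite inE (subsetP BSL _ bB) /= => nPb.
by exists b.
Qed.

(** The (i, j) entry vanishes exactly when b fixes the line of row i of P. The two elementary
    unipotent matrices used here have no common eigenline, so not all of SL_2 fixes it. *)
Lemma escape_line P i j : P \in unitmx -> i != j ->
  exists2 b, b \in B & frame P b i j != 0.
Proof.
move=> uP ij.
apply: (@generating_escape (fun b => frame P b i j == 0)).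
- by rewrite frame1 // mxE (negbTE ij) mulr0n.
- move=> g h _ _ /= /eqP eg /eqP eh.
  by rewrite frameM // (mulmx2N _ _ _ _ ij) eg eh mul0r mulr0 addr0.
have [u uSL eu] := @SL_mx2 1 1 0 1 ltac:(ring).
have [l lSL el] := @SL_mx2 1 0 1 1 ltac:(ring).
have [fu|fu] := eqVneq (frame P u i j) 0; last by exists u.
exists l => //; apply/negP => /eqP fl.
have entry g k : frame P g i j = 0 -> frame P g i i * P i k =
    P i 0 * phi (gmx g 0 k) + P i 1 * phi (gmx g 1 k).
  move=> f0; have := frame_mulP g uP; move/(congr1 (fun M : 'M_2 => M i k)).
  by rewrite (mulmx2N _ _ _ _ ij) f0 mul0r addr0 mulmx2E !mxE.
have := unitmx2_row i uP.
have := entry u 0 fu; have := entry u 1 fu; have := entry l 0 fl; have := entry l 1 fl.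
rewrite eu el !mx2E rmorph0 rmorph1 !mulr0 !mulr1 ?addr0 ?add0r.
move=> l1 l0 u1 u0; have [p1|p1 _] := eqVneq (P i 1) 0.
  rewrite orbF => p0; move: u0; rewrite -[RHS]mul1r => /(mulIf p0) f1.
  by move/eqP: u1; rewrite f1 mul1r -subr_eq0 opprD addrCA subrr addr0 oppr_eq0 (negbTE p0).
move: l1; rewrite -[RHS]mul1r => /(mulIf p1) f1.
by move/eqP: l0; rewrite f1 mul1r -subr_eq0 opprD addrA subrr add0r oppr_eq0 (negbTE p1).
Qed.

Hypothesis F_gt2 : (2 < #|F|)%N.

(** Monomial matrices preserve the pair of lines of the frame and are closed under products. Over
    the field with two elements all of SL_2 is monomial in the frame of an element of order three,
    whence the bound on |F|. *)
Lemma escape_monomial P : P \in unitmx -> exists2 b, b \in B &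
  ((frame P b 0 0 != 0) || (frame P b 1 1 != 0)) &&
  ((frame P b 0 1 != 0) || (frame P b 1 0 != 0)).
Proof.
move=> uP.
pose mono b := ((frame P b 0 0 == 0) && (frame P b 1 1 == 0)) ||
  ((frame P b 0 1 == 0) && (frame P b 1 0 == 0)).
have [|g h _ _||b bB nb] := @generating_escape mono; last 1 first.
- by exists b => //; move: nb; rewrite /mono negb_or !negb_and.
- by rewrite /mono !frame1 // !mxE /= !mulr0n eqxx orbT.
- rewrite /mono !frameM // !mulmx2E.
  by case/orP=> /andP[/eqP-> /eqP->]; case/orP=> /andP[/eqP-> /eqP->];
    rewrite ?(mul0r, mulr0, addr0, add0r) eqxx ?orbT.
have trans s : exists2 u, u \in SL 2 F & gmx u = mx2 1 s 0 1.
  by apply: SL_mx2; ring.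
have diagN0 s u : s != 0 -> u \in SL 2 F -> gmx u = mx2 1 s 0 1 -> mono u ->
    [/\ frame P u 0 0 = 0, frame P u 1 1 = 0, P 1 0 != 0,
      frame P u 0 1 * P 1 0 = P 0 0 &
      frame P u 0 1 * P 1 1 = P 0 0 * phi s + P 0 1].
  move=> sN0 uSL eu.
  have entry i k : frame P u i 0 * P 0 k + frame P u i 1 * P 1 k =
      P i 0 * phi (gmx u 0 k) + P i 1 * phi (gmx u 1 k).
    have := frame_mulP u uP; move/(congr1 (fun M : 'M_2 => M i k)).
    by rewrite !mulmx2E !mxE.
  have := unitmx2_col 0 uP.
  have := entry 0 0; have := entry 0 1; have := entry 1 0; have := entry 1 1.
  rewrite eu !mx2E rmorph0 rmorph1 !mulr0 !mulr1 !addr0.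
  have ps : phi s != 0 by rewrite fmorph_eq0.
  move=> e11 e10 e01 e00 c0.
  case/orP=> /andP[/eqP f1 /eqP f2].
    move: e11 e10 e01 e00; rewrite f1 f2 !mul0r !addr0 !add0r => e11 e10 e01 e00.
    split=> //; apply: contraTneq c0 => p10.
    by rewrite -e00 p10 mulr0 eqxx.
  move: e11 e10 e01 e00; rewrite f1 f2 !mul0r !addr0 !add0r => e11 e10 e01 e00.
  have eig f p p' : f * p = p -> f * p' = p * phi s + p' -> p = 0.
    have [//|pN0] := eqVneq p 0.
    rewrite -[in RHS](mul1r p) => /(mulIf pN0) ->.
    move/eqP; rewrite mul1r -subr_eq0 opprD addrCA subrr addr0 oppr_eq0.
    by rewrite mulf_eq0 (negbTE ps) orbF => /eqP.
  by move: c0; rewrite (eig _ _ _ e00 e01) (eig _ _ _ e10 e11) eqxx.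
have [u uSL eu] := trans 1.
have [mu|mu] := boolP (mono u); last by exists u.
(* If the unipotents with parameters 1 and s both swap the two lines, they have the same (0, 1)
   entry. Comparing the images of the first row gives P00 (s - 1) = 0, and then a zero
   determinant. *)
have [s /andP[sN0 sN1]] : exists s : F, (s != 0) && (s != 1).
  apply/existsP; apply: contraLR F_gt2 => /existsPn no; rewrite -leqNgt.
  rewrite -cardsT; apply: (@leq_trans #|[set (0 : F); 1]|).
    apply/subset_leq_card/subsetP => s _; have := no s.
    by rewrite !inE negb_and !negbK.
  by rewrite cards2; case: (_ == _).
have [v vSL ev] := trans s.
exists v => //; apply/negP => mv.
have [_ _ p10 e1 e2] := diagN0 1 u (oner_neq0 _) uSL eu mu.
have [_ _ _ e3 e4] := diagN0 s v sN0 vSL ev mv.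
have e13 : frame P u 0 1 = frame P v 0 1 by apply: (mulIf p10); rewrite e1 e3.
have : P 0 0 * phi s = P 0 0 * phi 1 by apply: (addIr (P 0 1)); rewrite -e2 -e4 e13.
move/eqP; rewrite -subr_eq0 -mulrBr mulf_eq0 -rmorphB fmorph_eq0 subr_eq0 (negbTE sN1) orbF.
move=> /eqP p00; have := frame_det1 phi uP uSL; have [f00 f11 _ _ _] := diagN0 1 u (oner_neq0 _) uSL eu mu.
move/eqP: e1; rewrite p00 mulf_eq0 (negbTE p10) orbF f00 => /eqP ->.
by rewrite !mul0r subrr => /eqP; rewrite eq_sym oner_eq0.
Qed.

End Escape.

(** * Tori as diagonal matrices in a frame *)

Section Torus.
Variables (F : finFieldType) (K : closedFieldType) (phi : {rmorphism F -> K}).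
Implicit Types (g h x : {'GL_2[F]}) (P Q : 'M[K]_2).

Local Notation frame := (@frame_mx F K phi).

Lemma comm_det_frame P g h : P \in unitmx ->
  comm_det (frame P g) (frame P h) = phi (comm_det (gmx g) (gmx h)).
Proof.
move=> uP; rewrite /comm_det -!frameM // -det_map_mx map_mxB -!gmxM.
rewrite frame_mx.unlock -mulmxBl -mulmxBr !det_mulmx det_inv mulrAC mulfV ?mul1r //.
by rewrite -unitfE -unitmxE.
Qed.

Definition diagonal P g := (frame P g 0 1 == 0) && (frame P g 1 0 == 0).

Lemma diagonal_entry P g : P \in unitmx -> g \in SL 2 F -> diagonal P g ->
  [/\ frame P g 0 1 = 0, frame P g 1 0 = 0, frame P g 0 0 != 0 &
      frame P g 1 1 = (frame P g 0 0)^-1].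
Proof.
move=> uP gSL /andP[/eqP g01 /eqP g10].
have := frame_det1 phi uP gSL; rewrite g01 mul0r subr0 => e.
have g0 : frame P g 0 0 != 0.
  by apply: contra_eq_neq e => ->; rewrite mul0r eq_sym oner_eq0.
by split=> //; apply: (mulfI g0); rewrite e mulfV.
Qed.

Lemma diagonal_inj P : P \in unitmx ->
  {in [pred g | (g \in SL 2 F) && diagonal P g] &, injective (fun g => frame P g 0 0)}.
Proof.
move=> uP g h /andP[gS gD] /andP[hS hD] /= e.
have [g01 g10 _ g11] := diagonal_entry uP gS gD.
have [h01 h10 _ h11] := diagonal_entry uP hS hD.
by apply: (frame_inj (phi := phi) uP); apply: matrix2P; rewrite ?g01 ?h01 ?g10 ?h10 ?g11 ?h11 ?e.
Qed.

(** With eigenvalues t and 1/t, one has (t + 1/t)^2 - 4 = (t - 1/t)^2. *)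
Lemma regularE P g : P \in unitmx -> g \in SL 2 F -> diagonal P g ->
  regular g = (frame P g 0 0 != frame P g 1 1).
Proof.
move=> uP gSL dg; have [g01 g10 g0 g11] := diagonal_entry uP gSL dg.
rewrite /regular -(fmorph_eq phi) rmorphXn rmorph_nat -(tr_frame phi g uP) mxtrace2.
rewrite -[in RHS]subr_eq0 -[in RHS]sqrf_eq0 -subr_eq0; congr (~~ (_ == _)).
by rewrite g11; field.
Qed.

Lemma commute_diagonal P x h : P \in unitmx -> x \in SL 2 F -> diagonal P x ->
  regular x -> commute x h -> diagonal P h.
Proof.
move=> uP xS dx; rewrite (regularE uP xS dx) -subr_eq0 => rx xh.
have := congr1 (frame P) xh; rewrite !frameM //.
case/andP: dx => /eqP x01 /eqP x10 e.
apply/andP; split; apply/eqP; apply: (mulfI rx); rewrite mulr0 mulrBl; apply/eqP; rewrite subr_eq0; apply/eqP.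
  have := congr1 (fun M : 'M_2 => M 0 1) e.
  by rewrite !mulmx2E ?x01 ?x10 ?(mul0r, mulr0, addr0, add0r) => ->; rewrite mulrC.
have := congr1 (fun M : 'M_2 => M 1 0) e.
by rewrite !mulmx2E ?x01 ?x10 ?(mul0r, mulr0, addr0, add0r) => ->; rewrite mulrC.
Qed.

Lemma cent1_GLP x h : reflect (commute x h) (h \in 'C[x]%g).
Proof. by apply: (iffP cent1P) => /esym. Qed.

Lemma diagonal_commute P x h : P \in unitmx -> diagonal P x -> diagonal P h ->
  commute x h.
Proof.
move=> uP /andP[/eqP x01 /eqP x10] /andP[/eqP h01 /eqP h10].
apply: (frame_inj (phi := phi) uP); rewrite !frameM //.
by apply: matrix2P; rewrite !mulmx2E ?x01 ?x10 ?h01 ?h10 ?(mul0r, mulr0, addr0, add0r) // mulrC.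
Qed.

Variable B : {set {'GL_2[F]}}.
Hypothesis BSL : B \subset SL 2 F.
Hypothesis Bgen : forall H : {group {'GL_2[F]}}, H \proper SL 2 F -> ~~ (B \subset H).
Hypothesis B1 : 1%g \in B.
Hypothesis BV : (B^-1)%g = B.
Hypothesis F_gt2 : (2 < #|F|)%N.

Lemma expg_SL k : (B ^+ k)%g \subset SL 2 F.
Proof.
elim: k => [|k IH]; first by rewrite expg0 sub1set group1.
rewrite expgS; apply: subset_trans (mulgSS BSL IH) _.
by rewrite (mulGid (SL_group 2 F)).
Qed.

(** Take u moving the first line and v moving the second. If neither moves both, u is upper and v
    lower triangular, and the off-diagonal entries of uv are products of nonzero entries. *)
Lemma escape_offdiag P : P \in unitmx ->
  exists2 h, h \in (B ^+ 2)%g & (frame P h 0 1 != 0) && (frame P h 1 0 != 0).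
Proof.
move=> uP.
have [u uB u01] := @escape_line _ _ phi _ BSL Bgen P 0 1 uP isT.
have [v vB v10] := @escape_line _ _ phi _ BSL Bgen P 1 0 uP isT.
have sub : B \subset (B ^+ 2)%g by rewrite -{1}[B]expg1 expg_set_sub.
have [u10|] := eqVneq (frame P u 1 0) 0; last first.
  by move=> u10; exists u; rewrite ?(subsetP sub) // u01.
have [v01|] := eqVneq (frame P v 0 1) 0; last first.
  by move=> v01; exists v; rewrite ?(subsetP sub) // v01.
exists (u * v)%g; first by rewrite expgS expg1 mem_mulg.
rewrite frameM // !mulmx2E u10 v01 mulr0 mul0r !add0r.
have := frame_det1 phi uP (subsetP BSL _ uB); rewrite u10 mulr0 subr0 => du.
have := frame_det1 phi uP (subsetP BSL _ vB); rewrite v01 mul0r subr0 => dv.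
have nz (a b : K) : a * b = 1 -> b != 0.
  by move=> ab; apply: contra_eq_neq ab => ->; rewrite mulr0 eq_sym oner_eq0.
by rewrite !mulf_neq0 // (nz _ _ du, nz _ _ dv).
Qed.

(** Supplies the h1, h2 for which three traces determine an element up to two choices. The
    commutator determinant is computed in a frame where h1 is diagonal or a Jordan block; there it
    is nonzero as soon as the off-diagonal entries of h2 are. *)
Lemma trace_pair : exists h1 h2,
  [/\ h1 \in B, h2 \in (B ^+ 2)%g & comm_det (gmx h1) (gmx h2) != 0].
Proof.
have u1 : (1%:M : 'M[K]_2) \in unitmx by exact: unitmx1.
(* A nonzero off-diagonal entry in the standard frame makes [h1] non-scalar. *)
have [h1 h1B h1N] := @escape_line _ _ phi _ BSL Bgen 1%:M 0 1 u1 isT.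
have h1S := subsetP BSL _ h1B.
suff [P uP [h2 h2B nz]] : exists2 P, P \in unitmx &
    exists2 h2, h2 \in (B ^+ 2)%g & comm_det (frame P h1) (frame P h2) != 0.
  by exists h1, h2; split; rewrite // -(fmorph_eq0 phi) -(comm_det_frame _ _ uP).
have [reg|nreg] := boolP (regular h1).
  have [P uP [d01 d10]] := regular_frame phi h1S reg.
  have [h2 h2B /andP[h01 h10]] := escape_offdiag uP.
  exists P => //; exists h2 => //.
  have := reg; rewrite (regularE uP h1S) /diagonal ?d01 ?d10 ?eqxx // -subr_eq0 => rx.
  rewrite /comm_det det2 !submx2E !mulmx2E d01 d10.
  rewrite (_ : _ - _ = (frame P h1 0 0 - frame P h1 1 1) ^+ 2 *
    (frame P h2 0 1 * frame P h2 1 0)); last by ring.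
  by rewrite !mulf_neq0 ?expf_neq0.
have nscal : ~~ is_scalar_mx (gmx h1).
  apply: contra h1N => /is_scalar_mxP[a ea].
  by rewrite frame_mx.unlock mul1mx invmx1 mulmx1 ea !mxE mulr0n rmorph0.
have [P uP [d00 d01 d10]] := nonregular_frame phi h1S nreg nscal.
have [h2 h2B /andP[_ h10]] := escape_offdiag uP.
exists P => //; exists h2 => //.
rewrite /comm_det det2 !submx2E !mulmx2E d00 d10.
rewrite (_ : _ - _ = - (frame P h1 0 1 * frame P h2 1 0) ^+ 2); last by ring.
by rewrite oppr_eq0 expf_neq0 // mulf_neq0.
Qed.

End Torus.

(** * Cubic bound for the part of B^2 in a torus *)

Lemma half_bound (d d' : nat) : (8 < d -> d <= d' + 4 -> d <= 2 * d')%N.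
Proof. lia. Qed.

(** The hypotheses give the factor 16; 512 = 8^3 is used because it also covers tori meeting B^2 in
    at most 8 elements. *)
Lemma cube_bound (d d' m : nat) :
  (d <= 2 * d' -> d * d' * d <= 8 * m -> d ^ 3 <= 512 * m)%N.
Proof.
move=> dd' h; apply: (@leq_trans (2 * (d * d' * d))%N); last by lia.
by rewrite !expnS expn0 muln1; nia.
Qed.

Section TorusBound.
Variables (F : finFieldType) (K : closedFieldType) (phi : {rmorphism F -> K}).
Implicit Types (g h x : {'GL_2[F]}) (P Q : 'M[K]_2).

Local Notation frame := (@frame_mx F K phi).
Local Notation diagonal := (@diagonal F K phi).

(** A torus element is determined by its first eigenvalue, and a quadratic without linear term has
    at most the two roots t and -t. *)
Lemma card_diagonal_sq P (A : {set {'GL_2[F]}}) (a b : K) : P \in unitmx ->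
  {in A, forall d, (d \in SL 2 F) && diagonal P d} -> (a != 0) || (b != 0) ->
  (#|[set d in A | a * frame P d 0 0 ^+ 2 + b == 0 :> K]%R| <= 2)%N.
Proof.
move=> uP dA ab.
have [a0|aN0] := eqVneq a 0.
  rewrite (_ : [set _ in _ | _] = set0) ?cards0 //; apply/setP => d.
  move: ab; rewrite a0 eqxx /= => b0.
  by rewrite !inE mul0r add0r (negbTE b0) andbF.
apply: card_le2P => x y z /[!inE] /andP[xA /eqP ex] /andP[yA /eqP ey] /andP[zA /eqP ez].
have inj u v : u \in A -> v \in A -> frame P u 0 0 = frame P v 0 0 -> u = v.
  by move=> uA vA; apply: (diagonal_inj uP); apply: dA.
have opp v : v \in A -> a * frame P v 0 0 ^+ 2 + b = 0 -> x != v ->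
    frame P v 0 0 = - frame P x 0 0.
  move=> vA ev xv; have : frame P x 0 0 ^+ 2 = frame P v 0 0 ^+ 2.
    by apply: (mulfI aN0); apply: (addIr b); rewrite ex ev.
  move/eqP; rewrite eqf_sqr => /orP[/eqP/inj e|/eqP->]; last by rewrite opprK.
  by rewrite e ?eqxx // in xv.
by move=> xy xz; apply: inj => //; rewrite (opp y) // (opp z).
Qed.

Variable B : {set {'GL_2[F]}}.
Hypothesis BSL : B \subset SL 2 F.
Hypothesis Bgen : forall H : {group {'GL_2[F]}}, H \proper SL 2 F -> ~~ (B \subset H).
Hypothesis B1 : 1%g \in B.
Hypothesis BV : (B^-1)%g = B.
Hypothesis F_gt2 : (2 < #|F|)%N.

(** The remaining case is h antidiagonal and z triangular but not diagonal: multiplying by h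
    exchanges the columns of z up to scalars, so the two nonzero diagonal entries of z move off the
    diagonal. *)
Lemma escape_three_entries P : P \in unitmx -> exists2 w, w \in (B ^+ 3)%g &
  [&& frame P w 0 1 != 0, frame P w 1 0 != 0 &
      (frame P w 0 0 != 0) || (frame P w 1 1 != 0)].
Proof.
move=> uP.
have [h hB /andP[h01 h10]] := escape_offdiag phi BSL Bgen B1 uP.
have [hdiag|hdiag] := boolP ((frame P h 0 0 != 0) || (frame P h 1 1 != 0)).
  exists h; last by rewrite h01 h10.
  by apply: subsetP hB; apply: expg_set_sub.
have [z zB /andP[z0 z1]] := escape_monomial phi BSL Bgen F_gt2 uP.
have [zoff|zoff] := boolP ((frame P z 0 1 != 0) && (frame P z 1 0 != 0)).
  exists z; last by rewrite andbA zoff z0.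
  by apply: subsetP zB; rewrite -{1}[B]expg1; apply: expg_set_sub.
exists (z * h)%g; first by rewrite expgS mem_mulg.
have dz := frame_det1 phi uP (subsetP BSL _ zB).
have zz : frame P z 0 1 * frame P z 1 0 = 0.
  by apply/eqP; rewrite mulf_eq0; move: zoff; rewrite negb_and !negbK.
move: dz; rewrite zz subr0 => dz.
have z00 : frame P z 0 0 != 0.
  by apply: contra_eq_neq dz => ->; rewrite mul0r eq_sym oner_eq0.
have z11 : frame P z 1 1 != 0.
  by apply: contra_eq_neq dz => ->; rewrite mulr0 eq_sym oner_eq0.
move: hdiag; rewrite negb_or !negbK => /andP[/eqP h00 /eqP h11].
rewrite frameM // !mulmx2E h00 h11 !mulr0 !add0r !addr0.
apply/and3P; split; try exact: mulf_neq0.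
by case/orP: z1 => z1; apply/orP; [left | right]; exact: mulf_neq0.
Qed.

Section Fixed.
Variables (P : 'M[K]_2) (x : {'GL_2[F]}).
Hypotheses (uP : P \in unitmx) (xS : x \in SL 2 F) (xD : diagonal P x).
Hypothesis xreg : regular x.

Let D := ((B ^+ 2) :&: 'C[x])%g.

Let DS d : d \in D -> (d \in SL 2 F) && diagonal P d.
Proof.
rewrite inE => /andP[dB /cent1_GLP dx].
apply/andP; split; first exact: subsetP (expg_SL BSL 2) _ dB.
exact: (@commute_diagonal F K phi P x d uP xS xD xreg dx).
Qed.

Let Dentry d : d \in D -> [/\ frame P d 0 1 = 0, frame P d 1 0 = 0,
  frame P d 0 0 != 0 & frame P d 1 1 = (frame P d 0 0)^-1].
Proof. by case/DS/andP => dS dd; apply: diagonal_entry. Qed.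

(** For d with eigenvalue t, each entry of w d w is, up to the factor t, a polynomial a t^2 + b. By
    the choice of w it is not identically zero, so each of the four entries excludes at most two
    d. *)
Lemma escape_all_entries : (8 < #|D|)%N -> exists2 g, g \in (B ^+ 8)%g &
  [&& frame P g 0 0 != 0, frame P g 0 1 != 0, frame P g 1 0 != 0 & frame P g 1 1 != 0].
Proof.
move=> D8; have [w wB /and3P[w01 w10 wd]] := escape_three_entries uP.
pose bad i j := [set d in D | frame P w i 0 * frame P w 0 j * frame P d 0 0 ^+ 2 +
                              frame P w i 1 * frame P w 1 j == 0].
have bad2 i j : (#|bad i j| <= 2)%N.
  apply: card_diagonal_sq => //.
  by case/orP: wd => wd; elim/ord2P: i; elim/ord2P: j; apply/orP;
    by [left; apply: mulf_neq0 | right; apply: mulf_neq0].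
have /subsetPn[d dD dbad] : ~~ (D \subset bad 0 0 :|: bad 0 1 :|: (bad 1 0 :|: bad 1 1)).
  apply: contraL D8 => /subset_leq_card Dbad; rewrite -leqNgt.
  apply: leq_trans Dbad _; apply: leq_trans (leq_card_setU _ _) _.
  rewrite -[8%N]/(4 + 4)%N; apply: leq_add;
    apply: leq_trans (leq_card_setU _ _) _; exact: (leq_add (bad2 _ _) (bad2 _ _)).
have [d01 d10 d0 d11] := Dentry dD.
exists (w * d * w)%g.
  rewrite (mem_expgM (j := 5)) // (mem_expgM (j := 3) (k := 2)) //.
  by case/setIP: dD.
have entry i j : d \notin bad i j -> frame P (w * d * w)%g i j != 0.
  rewrite inE dD /=; apply: contraNneq => e.
  have : frame P d 0 0 * frame P (w * d * w)%g i j = 0 by rewrite e mulr0.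
  rewrite !frameM // !mulmx2E d01 d10 d11 => <-; apply/eqP; field.
  exact: d0.
move: dbad; rewrite !in_setU !negb_or => /andP[/andP[b00 b01] /andP[b10 b11]].
by apply/and4P; split; apply: entry.
Qed.

(** The point of these formulas is that t and u cancel in the product of the two off-diagonal
    entries, which therefore depends on s alone. *)
Lemma torus_product g d1 s d2 : g \in SL 2 F -> d1 \in D -> s \in D -> d2 \in D ->
  let m := frame P (d1 * (g * s * g^-1) * d2)%g in
  let t := frame P d1 0 0 in let u := frame P d2 0 0 in let r := frame P s 0 0 in
  [/\ r * m 0 0 = t * u * (frame P g 0 0 * frame P g 1 1 * r ^+ 2 - frame P g 0 1 * frame P g 1 0),
      u * r * m 0 1 = - t * (frame P g 0 0 * frame P g 0 1) * (r ^+ 2 - 1) &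
      t * r * m 1 0 = u * (frame P g 1 0 * frame P g 1 1) * (r ^+ 2 - 1)].
Proof.
move=> gS /Dentry[a01 a10 a0 a11] /Dentry[s01 s10 s0 s11] /Dentry[b01 b10 b0 b11] /=.
rewrite !frameM // frameV //.
move: (frame P g) (frame P d1) (frame P d2) (frame P s) => fg f1 f2 fs in a01 a10 a0 a11 s01 s10 s0 s11 b01 b10 b0 b11 *.
rewrite !mulmx2E !mx2E a01 a10 a11 s01 s10 s11 b01 b10 b11.
by split; field; rewrite ?a0 ?s0 ?b0.
Qed.

Lemma torus_bound_large : (8 < #|D|)%N -> (#|D| ^ 3 <= 512 * #|(B ^+ 22)%g|)%N.
Proof.
move=> D8; have [g gB /and4P[g00 g01 g10 g11]] := escape_all_entries D8.
have gS : g \in SL 2 F by apply: subsetP gB; apply: expg_SL.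
(* [D1] collects the s that make the off-diagonal entries of the product vanish, [D2] those that
   make its (0, 0) entry vanish. *)
pose D1 := [set d in D | 1 * frame P d 0 0 ^+ 2 + -1 == 0].
pose D2 := [set d in D | frame P g 0 0 * frame P g 1 1 * frame P d 0 0 ^+ 2 +
                         - (frame P g 0 1 * frame P g 1 0) == 0].
pose D' := D :\: (D1 :|: D2).
have D1le : (#|D1| <= 2)%N by apply: card_diagonal_sq => //; rewrite oner_neq0.
have D2le : (#|D2| <= 2)%N by apply: card_diagonal_sq => //; rewrite mulf_neq0.
have D'ge : (#|D| <= 2 * #|D'|)%N.
  have : (#|D| <= #|D'| + 4)%N.
    rewrite -(cardsID (D1 :|: D2) D) addnC leq_add2l.
    apply: leq_trans (subset_leq_card (subsetIr _ _)) _.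
    by apply: leq_trans (leq_card_setU _ _) _; apply: (leq_add D1le D2le).
  exact: half_bound.
have D'D s : s \in D' -> [/\ s \in D, frame P s 0 0 ^+ 2 - 1 != 0 &
    frame P g 0 0 * frame P g 1 1 * frame P s 0 0 ^+ 2 - frame P g 0 1 * frame P g 1 0 != 0].
  by rewrite !inE => /andP[]; rewrite negb_or mul1r => h1 /andP[sB sC]; move: h1; rewrite sB sC /= => /andP[].
pose f (p : {'GL_2[F]} * {'GL_2[F]} * {'GL_2[F]}) := (p.1.1 * (g * p.1.2 * g^-1) * p.2)%g.
(* The exponent is 22 = 2 + (8 + 2 + 8) + 2. *)
have fB : {in setX (setX D D') D, forall p, f p \in (B ^+ 22)%g}.
  move=> [[d1 s] d2] /setXP[/setXP[/= /setIP[d1B _] /D'D[/setIP[sB _] _ _]] /setIP[d2B _]].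
  rewrite /f /= (mem_expgM (j := 20) (k := 2)) // (mem_expgM (j := 2) (k := 18)) //.
  by rewrite (mem_expgM (j := 10) (k := 8)) ?mem_expgV // (mem_expgM (j := 8) (k := 2)).
have inj := diagonal_inj (phi := phi) uP.
have injD u v : u \in D -> v \in D -> frame P u 0 0 = frame P v 0 0 -> u = v.
  by move=> /DS uD /DS vD; apply: inj.
suff fib : {in setX (setX D D') D, forall p,
    #|[set q in setX (setX D D') D | f q == f p]| <= 8}%N.
  have := leq_card_fiber fB fib; rewrite !cardsX; exact: cube_bound D'ge.
move=> [[t1 s0] t2] /setXP[/setXP[/= d1D0 s0D'] d2D0].
set p0 := (t1, s0, t2); pose r0 := frame P s0 0 0.
have [s0D sN0 sN0'] := D'D _ s0D'.
have [_ _ r0N0 _] := Dentry s0D.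
(* The off-diagonal product fixes (r^2 - 1)^2 / r^2, so r^2 is r0^2 or its inverse: four choices of
   s. Each leaves two choices of (d1, d2), so fibres have at most 8 elements. *)
pose Y := [set d in D | 1 * frame P d 0 0 ^+ 2 + - r0 ^+ 2 == 0] :|:
          [set d in D | r0 ^+ 2 * frame P d 0 0 ^+ 2 + - 1 == 0].
have Y4 : (#|Y| <= 4)%N.
  apply: leq_trans (leq_card_setU _ _) _; rewrite -[4%N]/(2 + 2)%N.
  by apply: leq_add; apply: card_diagonal_sq => //; rewrite ?oner_neq0 ?expf_neq0.
apply: (@leq_trans (2 * #|Y|)%N); last by rewrite -[8%N]/(2 * 4)%N leq_mul2l.
apply: (leq_card_fiber (f := fun q => q.1.2)).
  move=> [[d1 s] d2] /=; rewrite inE => /andP[/setXP[/setXP[/= d1D sD'] d2D] /eqP e].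
  have [sD _ _] := D'D _ sD'.
  have [_ h1 h2] := torus_product gS d1D sD d2D.
  have [_ k1 k2] := torus_product gS d1D0 s0D d2D0.
  have [_ _ rN0 _] := Dentry sD.
  have [_ _ tN0 _] := Dentry d1D. have [_ _ uN0 _] := Dentry d2D.
  have [_ _ t0N0 _] := Dentry d1D0. have [_ _ u0N0 _] := Dentry d2D0.
  move: h1 h2 k1 k2; rewrite -/r0 -[(_ * _ * d2)%g]/(f (d1, s, d2)) e -[(_ * _ * t2)%g]/(f p0).
  move: (frame P (f p0) 0 1) (frame P (f p0) 1 0) => m1 m2.
  move: tN0 uN0 rN0 t0N0 u0N0; rewrite -/r0.
  set t := frame P d1 0 0; set u := frame P d2 0 0; set r := frame P s 0 0.
  set t0 := frame P t1 0 0; set u0 := frame P t2 0 0.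
  move=> tN0 uN0 rN0 t0N0 u0N0 h1 h2 k1 k2.
  pose c := - (frame P g 0 0 * frame P g 0 1 * (frame P g 1 0 * frame P g 1 1)).
  have cN0 : c != 0 by rewrite oppr_eq0 !mulf_neq0.
  have hm : r ^+ 2 * (m1 * m2) = c * (r ^+ 2 - 1) ^+ 2.
    apply: (mulfI (mulf_neq0 tN0 uN0)).
    transitivity ((u * r * m1) * (t * r * m2)); first by ring.
    by rewrite h1 h2 /c; ring.
  have km : r0 ^+ 2 * (m1 * m2) = c * (r0 ^+ 2 - 1) ^+ 2.
    apply: (mulfI (mulf_neq0 t0N0 u0N0)).
    transitivity ((u0 * r0 * m1) * (t0 * r0 * m2)); first by ring.
    by rewrite k1 k2 /c; ring.
  have : c * ((1 * r ^+ 2 + - r0 ^+ 2) * (r0 ^+ 2 * r ^+ 2 + - 1)) = 0.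
    transitivity (r0 ^+ 2 * (c * (r ^+ 2 - 1) ^+ 2) - r ^+ 2 * (c * (r0 ^+ 2 - 1) ^+ 2)).
      by ring.
    by rewrite -hm -km; ring.
  move/eqP; rewrite mulf_eq0 (negbTE cN0) mulf_eq0 /= => h.
  by apply/setUP; case/orP: h => h; [left | right]; rewrite inE sD.
move=> q0 _; pose Phi q := [/\ q.1.1 \in D, q.2 \in D, f q = f p0 & q.1.2 \in D'].
(* With s fixed, the (0, 0) entry gives t u and the (0, 1) entry gives t / u. Hence t^2 is known,
   and t determines u. *)
have key q q' : Phi q -> Phi q' -> q.1.2 = q'.1.2 ->
    frame P q.1.1 0 0 ^+ 2 = frame P q'.1.1 0 0 ^+ 2 /\
    (frame P q.1.1 0 0 = frame P q'.1.1 0 0 -> q = q').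
  case: q q' => [[d s] e] [[d' s'] e'].
  rewrite /Phi /= => -[dD eD fq sD'] [d'D e'D fq' _] ss'.
  rewrite -{}ss' {s'} in fq' *.
  have [sD rN rN'] := D'D _ sD'; have [_ _ rN0 _] := Dentry sD.
  have [h0 h1 _] := torus_product gS dD sD eD.
  have [k0 k1 _] := torus_product gS d'D sD e'D.
  have [_ _ tN0 _] := Dentry dD. have [_ _ uN0 _] := Dentry eD.
  have [_ _ t'N0 _] := Dentry d'D. have [_ _ u'N0 _] := Dentry e'D.
  move: h0 h1 k0 k1; rewrite -[(_ * _ * e)%g]/(f (d, s, e)) fq.
  rewrite -[(_ * _ * e')%g]/(f (d', s, e')) fq'.
  move=> h0 h1 k0 k1.
  have tu : frame P d 0 0 * frame P e 0 0 = frame P d' 0 0 * frame P e' 0 0.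
    by apply: (mulIf rN'); rewrite -h0 -k0.
  have tu' : frame P d 0 0 * frame P e' 0 0 = frame P d' 0 0 * frame P e 0 0.
    apply: (mulIf rN); apply: (mulfI (mulf_neq0 g00 g01)); apply: oppr_inj.
    transitivity (frame P e' 0 0 * (- frame P d 0 0 * (frame P g 0 0 * frame P g 0 1) * (frame P s 0 0 ^+ 2 - 1))); first by ring.
    transitivity (frame P e 0 0 * (- frame P d' 0 0 * (frame P g 0 0 * frame P g 0 1) * (frame P s 0 0 ^+ 2 - 1))); last by ring.
    by rewrite -h1 -k1; ring.
  split.
    apply: (mulIf (mulf_neq0 uN0 u'N0)).
    transitivity ((frame P d 0 0 * frame P e 0 0) * (frame P d 0 0 * frame P e' 0 0)); first by ring.
    by rewrite tu tu'; ring.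
  move=> ee; have ed := injD _ _ dD d'D ee.
  by move: tu; rewrite ed => /(mulfI t'N0)/(injD _ _ eD e'D) ->.
have PhiP q : q \in [set y in [set y in setX (setX D D') D | f y == f p0] | y.1.2 == q0.1.2] ->
    Phi q /\ q.1.2 = q0.1.2.
  rewrite inE => /andP[+ /eqP ->]; rewrite inE => /andP[+ /eqP fq].
  by case: q fq => [[d s] e] fq /setXP[/setXP[/= dD sD'] eD].
apply: card_le2P => q1 q2 q3 /PhiP[Q1 e1] /PhiP[Q2 e2] /PhiP[Q3 e3] q12 q13.
have opp q : Phi q -> q.1.2 = q0.1.2 -> q1 != q ->
    frame P q.1.1 0 0 = - frame P q1.1.1 0 0.
  move=> Q e ne; have [] := key q q1 Q Q1 (etrans e (esym e1)).
  move/eqP; rewrite eqf_sqr => /orP[/eqP h /(_ h) qq|/eqP //].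
  by rewrite qq eqxx in ne.
have [_ ->//] := key q2 q3 Q2 Q3 (etrans e2 (esym e3)).
by rewrite (opp q2) // (opp q3).
Qed.

Lemma torus_bound : (#|D| ^ 3 <= 512 * #|(B ^+ 22)%g|)%N.
Proof.
have [|D8] := ltnP 8 #|D|; first exact: torus_bound_large.
apply: (@leq_trans (8 ^ 3)%N); first by rewrite leq_exp2r.
by rewrite leq_pmulr // card_gt0; apply/set0Pn; exists 1%g; apply: mem_expg_set.
Qed.

End Fixed.
End TorusBound.

(** * Regular elements and their centralizers *)

Section RegularElements.
Variable F : finFieldType.
Implicit Types (g h x y z : {'GL_2[F]}).

Lemma trace_conjg x g : \tr (gmx (x ^ g)%g) = \tr (gmx x).
Proof.
by rewrite conjgE gmxM mxtrace_mulC -gmxM mulgK.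
Qed.

Lemma closure_frame x : x \in SL 2 F -> regular x ->
  exists (K : closedFieldType) (phi : {rmorphism F -> K}) (P : 'M[K]_2),
    P \in unitmx /\ diagonal phi P x.
Proof.
move=> xS rx; have [K [phi _]] := countable_algebraic_closure F.
have [P uP [x01 x10]] := regular_frame phi xS rx.
by exists K, phi, P; split=> //; rewrite /diagonal x01 x10 eqxx.
Qed.

Lemma regular_cent1 x y h : x \in SL 2 F -> y \in SL 2 F -> regular x ->
  regular y -> y \in 'C[x]%g -> h \in 'C[x]%g -> h \in 'C[y]%g.
Proof.
move=> xS yS rx ry /cent1_GLP xy /cent1_GLP xh.
have [K [phi [P [uP dx]]]] := closure_frame xS rx.
apply/cent1_GLP; apply: (diagonal_commute (phi := phi) uP).
  exact: commute_diagonal uP xS dx rx xy.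
exact: commute_diagonal uP xS dx rx xh.
Qed.

(** In the frame of x, a non-regular element of the torus has an eigenvalue of square 1. *)
Lemma card_nonregular_cent1 x : x \in SL 2 F -> regular x ->
  (#|[set h in SL 2 F :&: 'C[x]%g | ~~ regular h]| <= 2)%N.
Proof.
move=> xS rx; have [K [phi [P [uP dx]]]] := closure_frame xS rx.
have dA : {in SL 2 F :&: 'C[x]%g, forall d, (d \in SL 2 F) && diagonal phi P d}.
  move=> d /setIP[dS /cent1_GLP xd]; rewrite dS.
  exact: commute_diagonal uP xS dx rx xd.
apply: leq_trans (card_diagonal_sq (a := 1) (b := -1) uP dA _); last by rewrite oner_neq0.
apply/subset_leq_card/subsetP => d; rewrite inE => /andP[dT nd].
rewrite inE dT /=.
have /andP[dS dd] := dA d dT.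
have [_ _ d0 d11] := diagonal_entry uP dS dd.
move: nd; rewrite (regularE uP dS dd) negbK d11 => /eqP e.
by rewrite mul1r expr2 {2}e mulfV // subrr.
Qed.

(** If z + 1/z = y + 1/y, then (z - y)(z y - 1) = 0. *)
Lemma cent1_trace x z y : x \in SL 2 F -> regular x ->
  z \in SL 2 F :&: 'C[x]%g -> y \in SL 2 F :&: 'C[x]%g ->
  \tr (gmx z) = \tr (gmx y) -> z = y \/ (z * y = 1)%g.
Proof.
move=> xS rx; have [K [phi [P [uP dx]]]] := closure_frame xS rx.
move=> /setIP[zS /cent1_GLP xz] /setIP[yS /cent1_GLP xy].
have dz := commute_diagonal uP xS dx rx xz.
have dy := commute_diagonal uP xS dx rx xy.
have [z01 z10 z0 z11] := diagonal_entry uP zS dz.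
have [y01 y10 y0 y11] := diagonal_entry uP yS dy.
move/(congr1 phi); rewrite -!(tr_frame phi _ uP) !mxtrace2 z11 y11 => e.
have /eqP : (frame_mx phi P z 0 0 - frame_mx phi P y 0 0) *
  (frame_mx phi P z 0 0 * frame_mx phi P y 0 0 - 1) = 0.
  transitivity (frame_mx phi P z 0 0 * frame_mx phi P y 0 0 *
    ((frame_mx phi P z 0 0 + (frame_mx phi P z 0 0)^-1) -
     (frame_mx phi P y 0 0 + (frame_mx phi P y 0 0)^-1))).
    by field; rewrite z0 y0.
  by rewrite e subrr mulr0.
rewrite mulf_eq0 !subr_eq0 => /orP[/eqP ezy|/eqP ezy]; [left | right].
  by apply: (diagonal_inj uP) ezy; apply/andP.
apply: (frame_inj (phi := phi) uP); rewrite frameM // frame1 // mx2_1.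
apply: matrix2P; rewrite !mulmx2E !mx2E ?z01 ?z10 ?z11 ?y01 ?y10 ?y11;
  rewrite ?(mul0r, mulr0, addr0, add0r) //.
by rewrite -invfM ezy invr1.
Qed.

End RegularElements.

(** * Numerical inequalities for the pivot argument *)

Lemma traces_arith (t r c n m : nat) : (t <= r + 2 -> c * r <= m -> n <= m ->
  n ^ 3 <= 512 * m * c ^ 3 -> 0 < m -> t ^ 3 * n ^ 3 <= 24 ^ 3 * m ^ 4)%N.
Proof.
move=> tr cr nm nc m0; case: r => [|r] in tr cr *.
  apply: (@leq_trans (2 ^ 3 * m ^ 3)%N).
    by apply: leq_mul; rewrite leq_exp2r.
  by rewrite (expnS m 3) mulnA leq_mul2r; apply/orP; right; lia.
(* With at least one regular trace the two exceptional ones are absorbed in a factor 3, and 24^3 =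
   3^3 * 512. *)
apply: (@leq_trans ((3 * r.+1) ^ 3 * (512 * m * c ^ 3))%N).
  by apply: leq_mul => //; rewrite leq_exp2r //; lia.
apply: (@leq_trans (24 ^ 3 * m * (c * r.+1) ^ 3)%N).
  by apply: eq_leq; ring.
by rewrite -mulnA leq_mul2l (expnS m 3) leq_mul2l leq_exp2r // cr !orbT.
Qed.

Lemma centralizer_arith (t d n m : nat) : (n <= d * (2 * t ^ 2) ->
  t ^ 3 * n ^ 3 <= 24 ^ 3 * m ^ 4 -> n ^ 9 <= 8 * 24 ^ 6 * m ^ 8 * d ^ 3)%N.
Proof.
move=> nd tn; rewrite -[9%N]/(3 + 6)%N expnD.
apply: (@leq_trans ((d * (2 * t ^ 2)) ^ 3 * n ^ 6)%N).
  by rewrite leq_mul2r leq_exp2r // nd orbT.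
apply: (@leq_trans (8 * d ^ 3 * (t ^ 3 * n ^ 3) ^ 2)%N).
  by apply: eq_leq; ring.
apply: (@leq_trans (8 * d ^ 3 * (24 ^ 3 * m ^ 4) ^ 2)%N).
  by rewrite leq_mul2l leq_exp2r // tn orbT.
by apply: eq_leq; ring.
Qed.

Lemma small_arith (n m : nat) : (n <= m -> n <= 16 ->
  n ^ 12 <= 64 * 24 ^ 6 * m ^ 11)%N.
Proof.
move=> nm n16; rewrite (expnS n 11); apply: leq_mul; last by rewrite leq_exp2r.
by apply: leq_trans n16 _; rewrite -[16%N]muln1 leq_mul // expn_gt0.
Qed.

(** The constant 64 is 8 times 2^3. The same conclusion is shared by [small_arith] and
    [pivot_arith], so that one hypothesis [big] contradicts all three. *)
Lemma small_centralizer_arith (n m d : nat) : (n <= m ->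
  n ^ 9 <= 8 * 24 ^ 6 * m ^ 8 * d ^ 3 -> d <= 2 -> n ^ 12 <= 64 * 24 ^ 6 * m ^ 11)%N.
Proof.
move=> nm nd d2; rewrite -[12%N]/(9 + 3)%N expnD.
apply: (@leq_trans (8 * 24 ^ 6 * m ^ 8 * 2 ^ 3 * m ^ 3)%N).
  apply: leq_mul; last by rewrite leq_exp2r.
  by apply: leq_trans nd _; rewrite leq_mul2l leq_exp2r // d2 orbT.
by apply: eq_leq; ring.
Qed.

Lemma pivot_arith (n m d : nat) : (n ^ 9 <= 8 * 24 ^ 6 * m ^ 8 * d ^ 3 ->
  n * d <= 2 * m -> n ^ 12 <= 64 * 24 ^ 6 * m ^ 11)%N.
Proof.
move=> nd h; rewrite -[12%N]/(9 + 3)%N expnD.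
apply: (@leq_trans (8 * 24 ^ 6 * m ^ 8 * d ^ 3 * n ^ 3)%N).
  by rewrite leq_mul2r nd orbT.
apply: (@leq_trans (8 * 24 ^ 6 * m ^ 8 * (n * d) ^ 3)%N).
  by apply: eq_leq; ring.
apply: (@leq_trans (8 * 24 ^ 6 * m ^ 8 * (2 * m) ^ 3)%N).
  by rewrite leq_mul2l leq_exp2r // h orbT.
by apply: eq_leq; ring.
Qed.

Lemma three_arith (r : nat) : (0 < r -> 2 + r <= 3 * r)%N.
Proof. lia. Qed.

Lemma final_arith (c g s m n : nat) : (c * g <= 2 * s * m -> s ^ 3 <= 512 * g ->
  n ^ 9 <= 8 * 24 ^ 6 * m ^ 8 * (3 * c) ^ 3 ->
  g ^ 2 * n ^ 9 <= 216 * 4096 * 24 ^ 6 * m ^ 11)%N.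
Proof.
case: g => [|g]; first by rewrite mul0n.
move=> cg sg nc; rewrite -(leq_pmul2l (ltn0Sn g)).
apply: (@leq_trans (g.+1 ^ 3 * (8 * 24 ^ 6 * m ^ 8 * (3 * c) ^ 3))%N).
  by rewrite mulnA -expnS leq_mul2l nc orbT.
apply: (@leq_trans (216 * 24 ^ 6 * m ^ 8 * (c * g.+1) ^ 3)%N).
  by apply: eq_leq; ring.
apply: (@leq_trans (216 * 24 ^ 6 * m ^ 8 * (2 * s * m) ^ 3)%N).
  by rewrite leq_mul2l leq_exp2r // cg orbT.
apply: (@leq_trans (216 * 24 ^ 6 * 8 * m ^ 11 * s ^ 3)%N).
  by apply: eq_leq; ring.
apply: (@leq_trans (216 * 24 ^ 6 * 8 * m ^ 11 * (512 * g.+1))%N).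
  by rewrite leq_mul2l sg orbT.
by apply: eq_leq; ring.
Qed.

(** * The pivot argument for a class function [tr] on a finite group *)

Section Pivot.
Variables (gT : finGroupType) (G : {group gT}) (T : finType).
Variables (tr : gT -> T) (reg : pred T).
Implicit Types (g h x y z : gT).
Local Open Scope group_scope.
Local Notation regular x := (reg (tr x)).

Hypothesis tr_conj : forall x g, tr (x ^ g) = tr x.
Hypothesis card_nonreg : (#|[set t | ~~ reg t]| <= 2)%N.
Hypothesis reg_cent : forall x y h, x \in G -> y \in G -> regular x ->
  regular y -> y \in 'C[x] -> h \in 'C[x] -> h \in 'C[y].
Hypothesis card_nonreg_cent : forall x, x \in G -> regular x ->
  (#|[set h in G :&: 'C[x] | ~~ regular h]| <= 2)%N.
Hypothesis cent_tr : forall x z y, x \in G -> regular x ->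
  z \in G :&: 'C[x] -> y \in G :&: 'C[x] -> tr z = tr y -> z = y \/ z * y = 1.
Hypothesis card_torus : forall x, x \in G -> regular x ->
  (#|G :&: 'C[x]| ^ 3 <= 512 * #|G|)%N.

Variable B : {set gT}.
Hypothesis BG : B \subset G.
Hypothesis B1 : 1 \in B.
Hypothesis BV : B^-1 = B.
Hypothesis Bgen : forall H : {group gT}, B \subset H -> G \subset H.
Hypothesis card_torus_B : forall x, x \in G -> regular x ->
  (#|B ^+ 2 :&: 'C[x]| ^ 3 <= 512 * #|B ^+ 22|)%N.

Variables h1 h2 : gT.
Hypothesis h1B : h1 \in B.
Hypothesis h2B : h2 \in B ^+ 2.
Hypothesis tr_coord : forall x, x \in G ->
  (#|[set y in G | [&& tr y == tr x, tr (y * h1) == tr (x * h1) &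
     tr (y * h2) == tr (x * h2)]]| <= 2)%N.

Let N := #|B|.
Let M := #|B ^+ 22|.
Let Tr k := [set tr y | y in B ^+ k].
Let D x := B ^+ 2 :&: 'C[x].

Let expBG k : B ^+ k \subset G.
Proof.
elim: k => [|k IH]; first by rewrite expg0 sub1G.
by rewrite expgS mul_subG.
Qed.

Let inG k x : x \in B ^+ k -> x \in G.
Proof. exact: subsetP. Qed.

Let leM k : (k <= 22)%N -> (#|B ^+ k| <= M)%N.
Proof. by move=> k22; apply: subset_leq_card; apply: expg_set_sub. Qed.

Let leN : (N <= M)%N.
Proof. by have := @leM 1 isT; rewrite expg1. Qed.

Let M_gt0 : (0 < M)%N.
Proof. by rewrite card_gt0; apply/set0Pn; exists 1; apply: mem_expg_set. Qed.

Let trTr k j x h : x \in B ^+ k -> h \in B ^+ j -> tr (x * h) \in Tr (k + j).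
Proof. by move=> xB hB; apply/imsetP; exists (x * h); rewrite ?mem_expgM. Qed.

Let h1B1 : h1 \in B ^+ 1.
Proof. by rewrite expg1. Qed.

(** Map b to x^b. If c and b have the same image, c b^-1 centralizes x and lies in B^2. *)
Lemma orbit_stabilizer k x : x \in B ^+ k ->
  (N <= #|D x| * #|[set y in B ^+ k.+2 | tr y == tr x]|)%N.
Proof.
move=> xB; apply: (leq_card_fiber (f := fun b => x ^ b)).
  move=> b bB; rewrite inE tr_conj eqxx andbT conjgE.
  rewrite -[k.+2]add1n (mem_expgM (j := 1) (k := k.+1)) ?expg1 //.
    by rewrite -[B]BV mem_invg invgK.
  by rewrite expgSr mem_mulg.
move=> b bB; apply: (leq_card_imset_inj (f := fun c => c * b^-1)).
  move=> c; rewrite inE => /andP[cB /eqP e]; rewrite inE; apply/andP; split.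
    by rewrite expgS expg1 mem_mulg // -[B]BV mem_invg invgK.
  by apply/cent1P/commute_sym/commgP/conjg_fixP; rewrite conjgM e conjgK.
by move=> c d _ _ /mulIg.
Qed.

(** With the trace of y fixed, y is determined up to two choices by the traces of y h1 and y h2,
    both of which lie in [Tr 7] since y is in B^5. *)
Lemma card_trace_class t :
  (#|[set y in B ^+ 5 | tr y == t]| <= 2 * #|Tr 7| ^ 2)%N.
Proof.
rewrite -mulnn -cardsX.
apply: (leq_card_fiber (f := fun y => (tr (y * h1), tr (y * h2)))) => y;
  rewrite inE => /andP[yB /eqP yt].
  apply/setXP; split; last exact: (trTr (k := 5) (j := 2)).
  apply: (subsetP (imsetS tr (_ : B ^+ 6 \subset B ^+ 7))); first exact: expg_set_sub.
  exact: (trTr (k := 5) (j := 1)).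
apply: leq_trans (tr_coord (inG yB)); apply/subset_leq_card/subsetP => z.
rewrite !inE => /andP[/andP[zB /eqP zt]]; rewrite xpair_eqE => ->.
by rewrite (inG zB) zt yt eqxx.
Qed.

Lemma card_traces : (#|Tr 7| ^ 3 * N ^ 3 <= 24 ^ 3 * M ^ 4)%N.
Proof.
(* The minimal such c replaces a real cube root: it bounds from below every class in B^9 that has a
   regular trace taken on B^7. These classes are disjoint. *)
have ex : exists c, (N ^ 3 <= 512 * M * c ^ 3)%N.
  by exists N; rewrite leq_pmull // muln_gt0.
case: (ex_minnP ex) => c cP cmin.
pose R := [set t in Tr 7 | reg t].
have TrR : (#|Tr 7| <= #|R| + 2)%N.
  rewrite -(cardsID [set t | reg t] (Tr 7)) leq_add //.
    by apply/subset_leq_card/subsetP => t; rewrite !inE.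
  apply: leq_trans card_nonreg; apply/subset_leq_card/subsetP => t.
  by rewrite !inE => /andP[].
apply: traces_arith TrR _ leN cP M_gt0.
apply: leq_trans (@leM 9 isT).
apply: (leq_imset_disjoint (f := tr)) => t; rewrite inE => /andP[/imsetP[x xB ->] rx].
apply: cmin; apply: (@leq_trans (#|D x| ^ 3 * #|[set y in B ^+ 9 | tr y == tr x]| ^ 3)%N).
  by rewrite -expnMn leq_exp2r // orbit_stabilizer.
by rewrite leq_mul2r card_torus_B ?orbT // (inG xB).
Qed.

Lemma regular_centralizer_large x : x \in B ^+ 3 -> regular x ->
  (N ^ 9 <= 8 * 24 ^ 6 * M ^ 8 * #|D x| ^ 3)%N.
Proof.
move=> xB rx.
have h := leq_trans (orbit_stabilizer xB) (leq_mul (leqnn _) (card_trace_class (tr x))).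
have := card_traces; move: h; move: #|Tr 7| #|D x| N M => t d n m.
exact: centralizer_arith.
Qed.

(** Otherwise y, y h1 and y h2 all have non-regular traces for y in B, at most two values each, so
    |B| is at most 2 * 2^3. *)
Lemma exists_regular : (16 < N)%N -> exists2 x, x \in B ^+ 3 & regular x.
Proof.
move=> N16; apply/exists_inP; apply: contraLR N16; rewrite negb_exists_in => /forall_inP nr.
rewrite -leqNgt; have Tr3 : (#|Tr 3| <= 2)%N.
  apply: leq_trans card_nonreg; apply/subset_leq_card/subsetP => _ /imsetP[x xB ->].
  by rewrite inE nr.
apply: (@leq_trans (2 * (#|Tr 3| * #|Tr 3| * #|Tr 3|))%N); last first.
  by rewrite -[16%N]/(2 * (2 * 2 * 2))%N leq_mul2l /= !leq_mul.
rewrite -!cardsX.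
apply: (leq_card_fiber (f := fun y => (tr y, tr (y * h1), tr (y * h2)))) => y yB.
  have yB1 : y \in B ^+ 1 by rewrite expg1.
  have Trle k j : (k <= j)%N -> Tr k \subset Tr j.
    by move=> kj; apply/imsetS/expg_set_sub.
  do 2?[apply/setXP; split] => /=.
  - by apply: (subsetP (Trle 1%N 3%N isT)); apply: imset_f.
  - by apply: (subsetP (Trle 2%N 3%N isT)); apply: (trTr (k := 1) (j := 1)).
  by apply: (trTr (k := 1) (j := 2)).
apply: leq_trans (tr_coord (subsetP BG _ yB)); apply/subset_leq_card/subsetP => z.
rewrite !inE !xpair_eqE => /andP[zB /andP[/andP[-> ->] ->]].
by rewrite (subsetP BG _ zB).
Qed.

Hypothesis big : (64 * 24 ^ 6 * M ^ 11 < N ^ 12)%N.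

(** x ranges over G rather than over a power of B, so that the property can be transported by
    conjugation. *)
Definition pivotal x := [&& x \in G, regular x & [exists y in D x, regular y]].

Lemma pivotalP x : reflect [/\ x \in G, regular x & exists2 y, y \in D x & regular y]
  (pivotal x).
Proof.
apply: (iffP and3P) => -[xG rx].
  by move/exists_inP => [y yD ry]; split=> //; exists y.
by case=> y yD ry; split=> //; apply/exists_inP; exists y.
Qed.

Lemma card_centralizer_regular x : x \in G -> regular x ->
  (#|D x| <= 2 + #|[set y in D x | regular y]|)%N.
Proof.
move=> xG rx; rewrite -(cardsID [set y | regular y] (D x)) addnC leq_add //.
  apply: leq_trans (card_nonreg_cent xG rx); apply/subset_leq_card/subsetP => y.
  rewrite inE => /andP[ny /setIP[yB yC]]; rewrite inE in_setI yC (inG yB) /=.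
  by move: ny; rewrite inE.
by apply/subset_leq_card/subsetP => y; rewrite !inE.
Qed.

(** The witness y lies in B^3 and has the same torus as x, so the lower bound for y passes to x. *)
Lemma pivotal_large x : pivotal x -> (N ^ 9 <= 8 * 24 ^ 6 * M ^ 8 * #|D x| ^ 3)%N.
Proof.
case/pivotalP => xG rx [y /setIP[yB yC] ry]; have yG := inG yB.
apply: leq_trans (regular_centralizer_large _ ry) _.
  by apply: subsetP yB; apply: expg_set_sub.
rewrite leq_mul2l leq_exp2r // subset_leq_card ?orbT //.
apply/subsetP => h /setIP[hB hC]; apply/setIP; split=> //.
by apply: reg_cent yG xG ry rx _ hC; rewrite cent1C.
Qed.

Lemma exists_pivotal : exists x, pivotal x.
Proof.
have N16 : (16 < N)%N.
  rewrite ltnNge; apply/negP => N16; move: big; rewrite ltnNge => /negP; apply.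
  exact: small_arith leN N16.
have [x xB rx] := exists_regular N16.
exists x; apply/pivotalP; split=> //; first exact: inG xB.
apply/exists_inP; apply: contraT; rewrite negb_exists_in => /forall_inP nr; exfalso.
have D2 : (#|D x| <= 2)%N.
  apply: leq_trans (card_centralizer_regular (inG xB) rx) _.
  rewrite (_ : [set _ in _ | _] = set0) ?cards0 //; apply/setP => y; rewrite inE in_set0.
  by apply/negP => /andP[yD ry]; move: (nr y yD); rewrite ry.
move: big; rewrite ltnNge => /negP; apply.
exact: (small_centralizer_arith leN (regular_centralizer_large xB rx)).
Qed.

(** Otherwise [D (x ^ b)] has at most two elements. If u d^b = u' d'^b, then d'^b (d^b)^-1 = u'^-1 u
    lies in it, so (u, d) has at most two companions and B^5 contains about |B| |D x| elements, too
    many by [big]. *)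
Lemma pivotal_conj_step x b : b \in B -> pivotal x -> pivotal (x ^ b).
Proof.
move=> bB ix; have := pivotal_large ix.
case/pivotalP: ix => xG rx [y yD ry] large.
have bG := subsetP BG _ bB.
have xbG : x ^ b \in G by rewrite groupJ.
apply/pivotalP; split; rewrite ?tr_conj //.
apply/exists_inP; apply: contraT; rewrite negb_exists_in => /forall_inP nr; exfalso.
have D2 : (#|D (x ^ b)| <= 2)%N.
  apply: leq_trans (card_centralizer_regular xbG _) _; rewrite ?tr_conj //.
  rewrite (_ : [set _ in _ | _] = set0) ?cards0 //; apply/setP => z; rewrite inE in_set0.
  by apply/negP => /andP[zD rz]; move: (nr z zD); rewrite rz.
move: big; rewrite ltnNge => /negP; apply.
suff h : (N * #|D x| <= 2 * M)%N by exact: pivot_arith large h.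
rewrite -cardsX; apply: leq_trans (leq_mul (leqnn 2) (@leM 5 isT)).
apply: (leq_card_fiber (f := fun p => p.1 * p.2 ^ b)).
  move=> [u d] /setXP[/= uB /setIP[dB _]].
  rewrite (mem_expgM (j := 1) (k := 4)) ?expg1 //.
  have bVB : b^-1 \in B by rewrite -BV mem_invg invgK.
  rewrite conjgE (mem_expgM (j := 1) (k := 3)) ?expg1 //.
  by rewrite (mem_expgM (j := 2) (k := 1)) ?expg1.
move=> [u d] /setXP[/= uB /setIP[dB dC]].
apply: leq_trans D2.
apply: (leq_card_imset_inj (f := fun p => p.2 ^ b * (d ^ b)^-1)).
  move=> [u' d'] /=; rewrite inE => /andP[/setXP[/= u'B /setIP[d'B d'C]] /eqP e].
  have eq : d' ^ b * (d ^ b)^-1 = u'^-1 * u.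
    by apply: (mulgI u'); rewrite mulgA e mulgK mulKVg.
  apply/setIP; split.
    by rewrite eq expgS expg1 mem_mulg // -BV mem_invg invgK.
  by rewrite -conjVg -conjMg cent1J memJ_conjg groupM // groupV.
move=> [u1 d1] [u2 d2] /=; rewrite !inE => /andP[_ /eqP e1] /andP[_ /eqP e2].
move=> /mulIg /conjg_inj ed; move: e1 e2; rewrite /= ed => e1 e2.
by have /mulIg -> : u1 * d2 ^ b = u2 * d2 ^ b by rewrite e1 e2.
Qed.

Lemma pivotal_conj x g : g \in G -> pivotal x -> pivotal (x ^ g).
Proof.
have gH : group_set [set g | [forall x, pivotal x ==> pivotal (x ^ g)]].
  apply/group_setP; split.
    by rewrite inE; apply/forall_inP => y; rewrite conjg1.
  move=> u v; rewrite !inE => /forall_inP hu /forall_inP hv.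
  by apply/forall_inP => y iy; rewrite conjgM hv // hu.
have /subsetP sub : G \subset Group gH.
  apply: Bgen; apply/subsetP => b bB; rewrite inE; apply/forall_inP => y.
  exact: pivotal_conj_step.
by move=> /sub; rewrite inE => /forall_inP h /h.
Qed.

Lemma pivot_count : (#|G| ^ 2 * N ^ 9 <= 216 * 4096 * 24 ^ 6 * M ^ 11)%N.
Proof.
have [x0 ix0] := exists_pivotal.
have [x0G rx0 _] := pivotalP _ ix0.
(* Double counting: for fixed y, few g carry y into the torus of x0; for fixed g, many y in B^2 lie
   in the conjugate torus. *)
pose Omega := [set p in setX G (B ^+ 2) | regular p.2 && (p.2 ^ p.1 \in 'C[x0])].
pose S := G :&: 'C[x0].
have upper : (#|Omega| <= 2 * #|S| * M)%N.
  apply: leq_trans (leq_mul (leqnn _) (@leM 2 isT)).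
  apply: (leq_card_fiber (f := snd)).
    by move=> [g y]; rewrite inE => /andP[/setXP[]].
  move=> [g y]; rewrite inE => /andP[/setXP[/= gG yB] /andP[ry ygC]].
  have yG := inG yB.
  have ygS : y ^ g \in S by rewrite inE groupJ.
  (* Conjugates of y in the torus share its trace, so only two are possible; the conjugators giving
     one of them form a coset of a centralizer embedding in S. *)
  apply: (@leq_trans (#|S| * #|[set (y ^ g)%g; ((y ^ g)^-1)%g]|)%N); last first.
    by rewrite mulnC leq_mul2r cards2; case: (_ != _); rewrite ?orbT.
  apply: (leq_card_fiber (f := fun p => p.2 ^ p.1)).
    move=> [h z] /=; rewrite inE => /andP[]; rewrite inE => /andP[/setXP[/= hG _] /andP[_ zhC]].
    move=> /eqP ez; rewrite {}ez in zhC *.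
    have yhS : y ^ h \in S by rewrite inE groupJ.
    have [|->|e] := cent_tr x0G rx0 yhS ygS; first by rewrite !tr_conj.
      by rewrite set21.
    by rewrite (_ : y ^ h = (y ^ g)^-1) ?set22 //; apply: (mulIg (y ^ g)); rewrite mulVg.
  move=> [h z]; rewrite inE => /andP[]; rewrite inE => /andP[/setXP[/= hG _] /andP[_ zhC]].
  move=> /eqP /= ez; rewrite {}ez {z} in zhC *.
  apply: (leq_card_imset_inj (f := fun p => h^-1 * p.1)).
    move=> [k z] /=; rewrite inE => /andP[]; rewrite inE => /andP[].
    rewrite inE => /andP[/setXP[/= kG _] _] /eqP /= -> /eqP e.
    apply/setIP; split; first by rewrite groupM ?groupV.
    have yhG : y ^ h \in G by rewrite groupJ.
    apply: (reg_cent yhG x0G _ rx0); [by rewrite tr_conj | by rewrite cent1C |].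
    by apply/cent1P/commute_sym/commgP/conjg_fixP; rewrite -conjgM mulKVg e.
  move=> [k z] [l w] kzF lwF /= /mulgI ->; congr pair.
  move: kzF; rewrite inE => /andP[]; rewrite inE => /andP[_ /eqP /= ->] _.
  by move: lwF; rewrite inE => /andP[]; rewrite inE => /andP[_ /eqP /= ->].
(* c bounds from below the regular elements of B^2 in any pivotal torus; the factor 3 accounts for
   the at most two non-regular ones. *)
have ex : exists c, (N ^ 9 <= 8 * 24 ^ 6 * M ^ 8 * (3 * c) ^ 3)%N.
  exists #|D x0|; apply: leq_trans (pivotal_large ix0) _.
  by rewrite leq_mul2l leq_exp2r // leq_pmull // orbT.
case: (ex_minnP ex) => c cP cmin.
have lower : (c * #|G| <= #|Omega|)%N.
  apply: (leq_imset_disjoint (f := fst)) => g gG.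
  pose x := x0 ^ g^-1.
  have ix : pivotal x by rewrite pivotal_conj // groupV.
  have [xG rx [y0 y0D ry0]] := pivotalP _ ix.
  apply: (@leq_trans #|[set y in D x | regular y]|); last first.
    apply: (leq_card_imset_inj (f := fun y => (g, y))); last by move=> y z _ _ [].
    move=> y; rewrite !inE /= => /andP[/andP[yB yC] ry]; rewrite gG yB ry eqxx /= andbT.
    have : y \in 'C[x] by rewrite inE.
    by rewrite -(memJ_conjg _ g) -cent1J /x conjgKV inE.
  apply: cmin; apply: leq_trans (pivotal_large ix) _.
  rewrite leq_mul2l leq_exp2r //; apply/orP; right.
  apply: leq_trans (card_centralizer_regular xG rx) _.
  have : (0 < #|[set y in D x | regular y]|)%N.
    by rewrite card_gt0; apply/set0Pn; exists y0; rewrite inE y0D.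
  exact: three_arith.
exact: final_arith (leq_trans lower upper) (card_torus x0G rx0) cP.
Qed.

End Pivot.

(** * The pivot hypotheses for SL_2 *)

Section SpecialLinear.
Variable F : finFieldType.
Variable B : {set {'GL_2[F]}}.
Hypothesis BSL : B \subset SL 2 F.
Hypothesis Bgen : forall H : {group {'GL_2[F]}}, H \proper SL 2 F -> ~~ (B \subset H).
Hypothesis B1 : 1%g \in B.
Hypothesis BV : (B^-1)%g = B.
Hypothesis F_gt2 : (2 < #|F|)%N.

Let trace (x : {'GL_2[F]}) : F := \tr (gmx x).
Let reg (t : F) := t ^+ 2 != 4%:R.

Lemma card_nonregular_trace : (#|[set t : F | ~~ reg t]| <= 2)%N.
Proof.
apply: (@leq_trans #|[set (2%:R : F); - 2%:R]|); last by rewrite cards2; case: (_ != _).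
apply/subset_leq_card/subsetP => t; rewrite !inE negbK -[4%N]/(2 * 2)%N natrM -expr2.
by rewrite eqf_sqr.
Qed.

Lemma trace_coord_fiber h1 h2 : comm_det (gmx h1) (gmx h2) != 0 ->
  forall x, x \in SL 2 F -> (#|[set y in SL 2 F | [&& trace y == trace x,
    trace (y * h1) == trace (x * h1) & trace (y * h2) == trace (x * h2)]]%g| <= 2)%N.
Proof.
move=> nz x xS; apply: card_le2P => u v w.
rewrite inE => /andP[uS /and3P[/eqP u0 /eqP u1 /eqP u2]].
rewrite inE => /andP[vS /and3P[/eqP v0 /eqP v1 /eqP v2]].
rewrite inE => /andP[wS /and3P[/eqP w0 /eqP w1 /eqP w2]] uv uw.
move: u0 u1 u2 v0 v1 v2 w0 w1 w2; rewrite /trace !gmxM => u0 u1 u2 v0 v1 v2 w0 w1 w2.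
apply: gmx_inj; apply: (trace_coordinates (X := gmx u) nz); rewrite ?SL_det ?u0 ?u1 ?u2 //;
  by apply: contra_neq (@gmx_inj F u _) _.
Qed.

Lemma torus_bound_SL x : x \in SL 2 F -> regular x ->
  (#|(B ^+ 2 :&: 'C[x])%g| ^ 3 <= 512 * #|(B ^+ 22)%g|)%N.
Proof.
move=> xS rx; have [K [phi [P [uP dx]]]] := closure_frame xS rx.
exact: torus_bound uP xS dx rx.
Qed.

Lemma generated_SL (H : {group {'GL_2[F]}}) : B \subset H -> SL 2 F \subset H.
Proof.
move=> BH; apply: contraT => nH.
have pH : (H :&: SL_group 2 F)%G \proper SL 2 F.
  rewrite properE subsetIr; apply: contra nH => /subset_trans; apply.
  exact: subsetIl.
by have := Bgen pH; rewrite subsetI BH BSL.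
Qed.

End SpecialLinear.

(** Take SL_2 itself as the generating set: all its positive powers are SL_2. *)
Lemma card_torus_SL (F : finFieldType) (x : {'GL_2[F]}) : (2 < #|F|)%N ->
  x \in SL 2 F -> regular x -> (#|(SL 2 F :&: 'C[x])%g| ^ 3 <= 512 * #|SL 2 F|)%N.
Proof.
move=> F2 xS rx.
have expSL k : (SL 2 F ^+ k.+1)%g = SL 2 F.
  elim: k => [|k IH]; first by rewrite expg1.
  by rewrite expgS IH (mulGid (SL_group 2 F)).
have := @torus_bound_SL F (SL 2 F) (subxx _) _ _ _ F2 x xS rx.
rewrite !expSL; apply.
- by move=> H; rewrite properE => /andP[].
- exact: (group1 (SL_group 2 F)).
exact: (invGid (SL_group 2 F)).
Qed.

Lemma SL2_growth (F : finFieldType) (B : {set {'GL_2[F]}}) :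
  B \subset SL 2 F ->
  (forall H : {group {'GL_2[F]}}, H \proper SL 2 F -> ~~ (B \subset H)) ->
  1%g \in B -> (B^-1)%g = B -> (2 < #|F|)%N ->
  (#|B| ^ 12 <= 64 * 24 ^ 6 * #|(B ^+ 22)%g| ^ 11)%N \/
  (#|SL 2 F| ^ 2 * #|B| ^ 9 <= 216 * 4096 * 24 ^ 6 * #|(B ^+ 22)%g| ^ 11)%N.
Proof.
move=> BSL Bgen B1 BV F2.
have [small|big] := leqP; [by left | right].
have [K [phi _]] := countable_algebraic_closure F.
have [h1 [h2 [h1B h2B nz]]] := trace_pair phi BSL Bgen B1.
apply: (@pivot_count _ (SL_group 2 F) F (fun x => \tr (gmx x)) (fun t => t ^+ 2 != 4%:R)
  _ _ _ _ _ _ B BSL B1 BV _ _ h1 h2 h1B h2B _ big).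
- exact: trace_conjg.
- exact: card_nonregular_trace.
- exact: regular_cent1.
- exact: card_nonregular_cent1.
- exact: cent1_trace.
- by move=> x; apply: card_torus_SL.
- exact: generated_SL.
- exact: torus_bound_SL.
exact: trace_coord_fiber.
Qed.

(** * From powers of B back to the triple product of S *)

(** Raising the bound on M to the power 11 turns the exponent e + 9 into e + 229 and gives b^231.
    Substituting c m^3 / n^2 for b adds 462 on the left and yields 693 = 3 * 231 on the right. *)
Lemma ruzsa_arith (a c C e n b m N M : nat) : (0 < n -> n <= N ->
  n ^ 2 * b <= c * m ^ 3 -> M * N ^ 21 <= b ^ 21 * N ->
  a * N ^ (e + 9) <= C * M ^ 11 ->
  a * n ^ (e + 691) <= C * c ^ 231 * m ^ 693)%N.
Proof.
move=> n0 nN nb MN aN; have N0 : (0 < N)%N by apply: leq_trans nN.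
have step : (a * N ^ (e + 229) <= C * b ^ 231)%N.
  rewrite -(leq_pmul2r (_ : 0 < N ^ 11)%N); last by rewrite expn_gt0 N0.
  apply: (@leq_trans (a * N ^ (e + 9) * (N ^ 21) ^ 11)%N).
    by rewrite -!mulnA leq_mul2l -expnM -!expnD leq_eqVlt -!addnA eqxx orbT.
  apply: (@leq_trans (C * M ^ 11 * (N ^ 21) ^ 11)%N).
    by rewrite leq_mul2r aN orbT.
  apply: (@leq_trans (C * (b ^ 21 * N) ^ 11)%N).
    by rewrite -mulnA -expnMn leq_mul2l leq_exp2r // MN orbT.
  by rewrite expnMn -expnM mulnA.
rewrite -[691%N]/(229 + 2 * 231)%N addnA expnD expnM mulnA.
apply: (@leq_trans (C * b ^ 231 * (n ^ 2) ^ 231)%N).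
  rewrite leq_mul2r; apply/orP; right; apply: leq_trans step.
  by rewrite leq_mul2l; case: e {aN} => [|e]; rewrite leq_exp2r ?nN ?orbT.
have pow k : (b ^ k * (n ^ 2) ^ k <= c ^ k * m ^ (3 * k))%N.
  rewrite expnM -!expnMn mulnC; case: k => [|k]; first by rewrite !expn0.
  by rewrite leq_exp2r.
by rewrite -[X in (X <= _)%N]mulnA -[X in (_ <= X)%N]mulnA leq_mul2l (pow 231%N) orbT.
Qed.

Lemma card_GL2 (F : finFieldType) : (#|{: {'GL_2[F]}}| <= #|F| ^ 4)%N.
Proof. by have := leq_card _ (@gmx_inj F); rewrite card_mx. Qed.

Lemma tripling_dichotomy : exists C : nat, (0 < C)%N /\
  forall (F : finFieldType) (S : {set {'GL_2[F]}}),
    S \subset SL 2 F -> S != set0 ->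
    (forall H : {group {'GL_2[F]}}, H \proper SL 2 F -> ~~ (S \subset H)) ->
    (#|S| ^ 694 <= C * #|(S * S * S)%g| ^ 693)%N \/
    (#|SL 2 F| ^ 2 * #|S| ^ 691 <= C * #|(S * S * S)%g| ^ 693)%N.
Proof.
(* The term 16 bounds |S| when |F| = 2; the other two come from the alternatives of [SL2_growth],
   with 27^231 from symmetrization. *)
exists (16 + (64 * 24 ^ 6 * 27 ^ 231 + 216 * 4096 * 24 ^ 6 * 27 ^ 231))%N.
split=> // F S SSL S0 Sgen.
have S_gt0 : (0 < #|S|)%N by rewrite card_gt0.
set m := #|(S * S * S)%g|.
have [F2|F_gt2] := leqP #|F| 2.
  left; apply: (@leq_trans (16 * m ^ 693)%N); last by rewrite leq_mul2r leq_addr orbT.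
  rewrite (expnS _ 693) leq_mul //.
    apply: leq_trans (max_card _) _; apply: leq_trans (card_GL2 F) _.
    by rewrite -[16%N]/(2 ^ 4)%N leq_exp2r.
  rewrite leq_exp2r //; apply: leq_trans (leq_card_mulr S S0) _.
  exact: leq_card_mulr.
pose B := (S :|: S^-1 :|: 1)%g.
have tripling : (#|S| ^ 2 * #|(B ^+ 3)%g| <= 27 * m ^ 3)%N := card_symmetric_cube S0.
have SB : S \subset B by rewrite /B -setUA subsetUl.
have B1 : 1%g \in B by rewrite !inE eqxx orbT.
have BV : (B^-1)%g = B.
  by rewrite /B !invUg invg1 invgK [(S^-1 :|: S)%g]setUC.
have BSL : B \subset SL 2 F.
  rewrite !subUset SSL sub1set (group1 (SL_group 2 F)) andbT /=.
  by rewrite -(invGid (SL_group 2 F)) invSg.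
have Bgen (H : {group {'GL_2[F]}}) : H \proper SL 2 F -> ~~ (B \subset H).
  by move/Sgen; apply: contra; apply: subset_trans.
have powB := leq_card_expg BV 21.
have SBc := subset_leq_card SB.
case: (SL2_growth BSL Bgen B1 BV F_gt2) => h; [left | right].
  rewrite -[X in (X <= _)%N]mul1n.
  apply: leq_trans (@ruzsa_arith 1 27 _ 3 _ _ m _ _ S_gt0 SBc tripling powB _) _.
    by rewrite mul1n; exact: h.
  by rewrite leq_mul2r addnCA leq_addr orbT.
apply: leq_trans (@ruzsa_arith _ 27 _ 0 _ _ m _ _ S_gt0 SBc tripling powB h) _.
by rewrite leq_mul2r addnA leq_addl orbT.
Qed.

Theorem mainTheorem5 (R : realType) (eps : R) (eps_gt0 : 0 < eps) :
  exists delta c : R, [/\ 0 < delta, 0 < c &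
    forall (p k : nat) (p_prime : prime p) (k_ge1 : (1 <= k)%N)
           (F : finFieldType) (F_card : #|F| = (p ^ k)%N)
           (S : {set {'GL_2[F]}}),
      S \subset SL 2 F ->
      (forall H : {group {'GL_2[F]}}, H \proper SL 2 F -> ~~ (S \subset H)) ->
      (#|S|%:R : R) < (#|SL 2 F|%:R : R) `^ (1 - eps) ->
      c * (#|S|%:R : R) `^ (1 + delta) <= (#|(S * S * S)%g|%:R : R)].
Proof.
have [C [C0 dich]] := tripling_dichotomy.
(* The first alternative gains one power of |S| out of 693, the second 2 eps powers, by way of |G|
   >= |S|^(1 + eps). *)
pose e := Num.min 1 (2 * eps).
have e0 : 0 < e by rewrite lt_min ltr01 mulr_gt0.
have C0R : (0 : R) < C%:R by rewrite ltr0n.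
exists (e / 693), (C%:R^-1 `^ 693^-1); split.
- by rewrite divr_gt0.
- by rewrite powR_gt0 // invr_gt0.
move=> p k p_prime k_ge1 F F_card S SSL Sgen Ssmall.
(* For empty S the left side is 0, because 0 to the nonzero power 1 + delta is 0. *)
have [->|S0] := eqVneq S set0.
  rewrite cards0 powR0 ?mulr0 //.
  by rewrite gt_eqF // addr_gt0 // divr_gt0.
set m := #|(S * S * S)%g|; set n := #|S| in Ssmall *; set g := #|SL 2 F| in Ssmall *.
have n1 : (1 : R) <= n%:R by rewrite ler1n card_gt0.
have n0 : (0 : R) < n%:R by exact: lt_le_trans n1.
have g1 : (1 : R) <= g%:R.
  by rewrite ler1n card_gt0; apply/set0Pn; exists 1%g; exact: (group1 (SL_group 2 F)).
have g0 : (0 : R) < g%:R by exact: lt_le_trans g1.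
(* Raise the smallness hypothesis to the power 1 + eps and use (1 - eps)(1 + eps) <= 1. *)
have gn : n%:R `^ (1 + eps) <= (g%:R : R).
  apply: (@le_trans _ _ ((g%:R `^ (1 - eps)) `^ (1 + eps))).
    by apply: ge0_ler_powR (ltW Ssmall); rewrite ?nnegrE ?powR_ge0 ?(ltW g0) // addr_ge0 ?(ltW eps_gt0).
  rewrite -powRrM -[leRHS]powRr1; last exact: ltW.
  apply: ler_powR => //.
  by rewrite (_ : _ * _ = 1 - eps ^+ 2); [rewrite gerBl sqr_ge0 | ring].
have key : n%:R `^ (693 + e) <= C%:R * m%:R ^+ 693 :> R.
  have nE r : n%:R `^ (r%:R) = n%:R ^+ r :> R by rewrite powR_mulrn // (ltW n0).
  case: (dich F S SSL S0 Sgen) => h.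
    apply: (@le_trans _ _ (n%:R `^ (694%:R))).
      apply: (ler_powR n1); rewrite -[694%N]/(693 + 1)%N natrD lerD2l.
      by rewrite /e ge_min lexx.
    by rewrite nE -!natrX -natrM ler_nat.
  apply: (@le_trans _ _ (g%:R ^+ 2 * n%:R ^+ 691)); last first.
    by rewrite -!natrX -!natrM ler_nat.
  apply: (@le_trans _ _ (n%:R `^ (1 + eps) ^+ 2 * n%:R ^+ 691)); last first.
    by rewrite ler_wpM2r ?exprn_ge0 ?(ltW n0) // ler_sqr ?nnegrE ?powR_ge0 ?(ltW g0).
  rewrite -nE -powR_mulrn ?powR_ge0 // -powRrM -powRD; last first.
    by rewrite (gt_eqF n0) implybT.
  apply: ler_powR => //.
  rewrite (_ : (1 + eps) * 2%:R + 691%:R = 693 + 2 * eps); last by ring.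
  by rewrite lerD2l /e ge_min lexx orbT.
have ->: n%:R `^ (1 + e / 693) = (n%:R `^ (693 + e)) `^ 693^-1 :> R.
  by rewrite -powRrM; congr (_ `^ _); field.
rewrite -powRM ?invr_ge0 ?powR_ge0 ?(ltW C0R) //.
have -> : (m%:R : R) = (m%:R ^+ 693) `^ 693^-1.
  by rewrite -powR_mulrn // -powRrM mulfV ?powRr1 // pnatr_eq0.
apply: ge0_ler_powR.
- by rewrite invr_ge0 ler0n.
- by rewrite nnegrE mulr_ge0 ?powR_ge0 // invr_ge0 (ltW C0R).
- by rewrite nnegrE exprn_ge0 // ler0n.
by rewrite mulrC ler_pdivrMr // mulrC.
Qed.
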